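(* Let $d\in\mathbb{N}^+$ and let $0<\alpha<1$ with $1>\alpha d$. Let $\{X(t):t\in\mathbb{R}\}$ be a $d$-dimensional fractional Brownian motion of Hurst index $\alpha$. Let $A\subset\mathbb{R}$ be an analytic set with $\dim_P A=\beta$. Then, almost surely, $$\dim_P X^*(A)\ge \max\left\{\frac{\beta d}{\alpha d+\beta(1-\alpha d)},\ \beta(d+1-\alpha d)\right\}.$$
   Context: $\dim_P$ denotes packing dimension. $X^*(t)=(t,X(t))$, so $X^*(A)$ is the graph of $X|_A$. A $d$-dimensional fractional Brownian motion of Hurst index $\alpha$ on $\mathbb{R}$ is $X=(X_1,\dots,X_d)$ with $X_i$ i.i.d. copies of a centered real Gaussian process $X_0$ with $X_0(0)=0$, almost surely continuous paths and $\mathrm{Cov}(X_0(t),X_0(s))=\frac12(|t|^{2\alpha}+|s|^{2\alpha}-|t-s|^{2\alpha})$. *)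

(* Defs.v *)
From HB Require Import structures.
From mathcomp Require Import all_boot all_order all_algebra.
From mathcomp Require Import all_classical all_reals all_analysis.
Set Implicit Arguments. Unset Strict Implicit. Unset Printing Implicit Defensive.
Import Order.TTheory GRing.Theory Num.Theory.
Import numFieldNormedType.Exports.
Local Open Scope classical_set_scope.
Local Open Scope ring_scope.

Definition covering_number {R : realType} {V : pseudoMetricType R}
  (E : set V) (r : R) : \bar R :=
  ereal_inf [set (n%:R)%:E | n in
    [set n : nat | exists c : 'I_n -> V, E `<=` \bigcup_(i in setT) ball (c i) r]].

Definition box_ratio {R : realType} {V : pseudoMetricType R}
  (E : set V) (r : R) : \bar R :=
  match covering_number E r with
  | EFin n => ((ln n) / (- ln r))%:E
  | _ => +oo%E
  end.

Definition upper_box_dim {R : realType} {V : pseudoMetricType R}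
  (E : set V) : \bar R :=
  ereal_inf [set ereal_sup [set box_ratio E r | r in `]0, delta[ ]
            | delta in `]0, 1[ ].

Definition packing_dim {R : realType} {V : pseudoMetricType R}
  (E : set V) : \bar R :=
  ereal_inf [set s | exists F : nat -> set V,
     E `<=` \bigcup_(i in setT) F i /\
     s = ereal_sup [set upper_box_dim (F i) | i in setT]].

Definition baire_continuous {R : realType} (f : (nat -> nat) -> R) : Prop :=
  forall (x : nat -> nat) (eps : R), 0 < eps ->
    exists n : nat, forall y : nat -> nat,
      (forall k, (k < n)%N -> y k = x k) -> `|f y - f x| < eps.

Definition analytic_set {R : realType} (A : set R) : Prop :=
  A = set0 \/ exists f : (nat -> nat) -> R, baire_continuous f /\ range f = A.

Definition centered_gaussian {R : realType} {dT : measure_display}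
  {T : measurableType dT} (P : probability T R) (Y : T -> R) (v : R) : Prop :=
  measurable_fun setT Y /\
  forall B : set R, measurable B ->
    P (Y @^-1` B) = (if v == 0 then \d_(0:R) B else normal_prob 0 (Num.sqrt v) B).

Definition fbm_cov {R : realType} (alpha : R) (t s : R) : R :=
  (`|t| `^ (2 * alpha) + `|s| `^ (2 * alpha) - `|t - s| `^ (2 * alpha)) / 2.

(** d-dimensional fractional Brownian motion of Hurst index alpha:
    the family (X_i(t))_{i,t} is jointly centered Gaussian with
    Cov(X_i(t), X_j(s)) = [i = j] fbm_cov alpha t s (so the coordinates are
    i.i.d. copies of a real fBm), X(0) = 0 and paths are continuous a.s. *)
Definition is_fbm {R : realType} {dT : measure_display} {T : measurableType dT}
  (P : probability T R) (d : nat) (alpha : R) (X : R -> T -> 'rV[R]_d) : Prop :=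
  (forall (n : nat) (ts : 'I_n -> R) (ix : 'I_n -> 'I_d) (cs : 'I_n -> R),
     centered_gaussian P
       (fun w => \sum_(k < n) cs k * X (ts k) w ord0 (ix k))
       (\sum_(j < n) \sum_(k < n)
          cs j * cs k * (if ix j == ix k then fbm_cov alpha (ts j) (ts k) else 0)))
  /\ {ae P, forall w, X 0 w = 0}
  /\ {ae P, forall w, continuous (fun t => X t w)}.

Definition graph_on {R : realType} {T : Type} (d : nat)
  (X : R -> T -> 'rV[R]_d) (w : T) (A : set R) : set (R * 'rV[R]_d) :=
  (fun t => (t, X t w)) @` A.

(* Main.v *)
Require Import Defs.
From mathcomp Require Import all_boot all_order all_algebra.
From mathcomp Require Import all_classical all_reals all_analysis.
From mathcomp Require Import measurable_realfun.
From mathcomp Require Import ring lra.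
Set Implicit Arguments.
Unset Strict Implicit.
Unset Printing Implicit Defensive.
Import Order.TTheory GRing.Theory Num.Theory.
Import numFieldNormedType.Exports.
Local Open Scope classical_set_scope.
Local Open Scope ring_scope.

(** Let [0 <= g < beta]. If [E] has upper box dimension above [g], then at
    arbitrarily small scales [r] it contains [N ~ r^-g] points that are
    [r]-separated. Put [rho = r^theta] and count the pairs of these points whose
    graph points are [rho]-close, with the Gaussian kernel in place of the
    indicator. Since [X t - X s] is Gaussian of variance [|t - s|^(2 alpha)], the
    expected number of pairs is at most
    [N + N * \sum_(k <= m) rho^d (k r)^(- alpha d)] up to a constant, where [k]
    may be restricted to [k <= N] or to [k <= 4 rho / r]. As [alpha d < 1], this
    is [O(N)] when [theta d = alpha d + g (1 - alpha d)] in the first case and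
    when [theta (d + 1 - alpha d) = 1] in the second. By Markov's inequality and
    Cauchy-Schwarz, at arbitrarily small scales [rho] the graph over [E] needs
    almost [N = rho^-(g / theta)] balls, almost surely: this gives the two bounds
    for upper box dimensions.

    For packing dimension, write [A] as the image of the Baire space under a
    continuous map, delete the countably many cylinders whose images have packing
    dimension at most [g], and apply the box estimate simultaneously to the images
    of all cylinders of the remaining closed set. The Baire category theorem in
    that closed set shows that any countable cover of the graph over [A] has a
    member that is dense in the graph over one of these images. *)

Section improper_integral.
Context {R : realType}.
Local Notation mu := (@lebesgue_measure R).

Lemma cvg_integral_exhaustion d (T : measurableType d)
    (nu : {measure set T -> \bar R}) (D : nat -> set T) (f : T -> R) :
  (forall n, measurable (D n)) -> (forall x, \forall n \near \oo, D n x) ->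
  nu.-integrable setT (EFin \o f) ->
  (\int[nu]_(x in D n) (f x)%:E @[n --> \oo] --> \int[nu]_x (f x)%:E)%E.
Proof.
move=> mD Dx intf; under eq_fun do rewrite integral_mkcond.
have mf : measurable_fun setT (EFin \o f) by case/integrableP: intf.
apply: (@dominated_cvg _ _ _ _ _ _ _ _ (abse \o EFin \o f)) => //=.
- move=> n; apply/(measurable_restrictT _ _).1 => //.
  exact: measurable_funTS.
- move=> x _; apply: cvg_near_cst; apply: filterS (Dx x) => n Dnx.
  by rewrite patchE mem_set.
- exact: integrable_abse.
- by move=> n x _; rewrite patchE; case: ifPn => // _; rewrite abse0.
Qed.

Lemma cvg_symmetric_FTC2 (F f : R -> R) :
  (forall x : R, is_derive x 1 F (f x)) -> continuous f ->
  mu.-integrable setT (EFin \o f) ->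
  F n%:R - F (- n%:R) @[n --> \oo] --> \int[mu]_x f x.
Proof.
move=> dF cf intf.
have cF (x : R) : {for x, continuous F}.
  by apply/differentiable_continuous/derivable1_diffP; have [] := dF x.
pose I n : set R := `[- n%:R, n%:R]%classic.
have FTC n : (\int[mu]_(x in I n) (f x)%:E = (F n%:R - F (- n%:R))%:E)%E.
  have [->|n_gt0] := posnP n; first by rewrite /I oppr0 set_itv1 integral_set1 subrr.
  apply: continuous_FTC2.
  - by rewrite gtrN// ltr0n.
  - exact: continuous_subspaceT.
  - split=> [x _||]; first by have [] := dF x.
    + by apply: cvg_at_right_filter; exact: cF.
    + by apply: cvg_at_left_filter; exact: cF.
  - by move=> x _; rewrite derive1E; have [] := dF x.
have fin_int : (\int[mu]_x (f x)%:E)%E \is a fin_num by exact: integrable_fin_num.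
suff /fine_cvgP[] : (F n%:R - F (- n%:R))%:E @[n --> \oo] -->
    (\int[mu]_x f x)%:E by [].
rewrite fineK//; under eq_fun do rewrite -FTC.
apply: cvg_integral_exhaustion => // [n|x]; first exact: measurable_itv.
near=> n; rewrite /I/= in_itv/= -ler_norml.
by near: n; exact: nbhs_infty_ger.
Unshelve. all: end_near. Qed.

End improper_integral.

Section normal_Fourier_transform.
Context {R : realType}.
Local Notation mu := (@lebesgue_measure R).

Lemma is_derive_sinMl (a x : R) :
  is_derive x 1 (fun z => sin (a * z)) (a * cos (a * x)).
Proof.
have -> : (fun z => sin (a * z)) = sin \o (a \*: (@id R)) by [].
by apply: is_derive_eq; rewrite mulrC /= /GRing.scale/= mulr1.
Qed.

Lemma is_derive_cosMl (a x : R) :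
  is_derive x 1 (fun z => cos (a * z)) (- (a * sin (a * x))).
Proof.
have -> : (fun z => cos (a * z)) = cos \o (a \*: (@id R)) by [].
by apply: is_derive_eq; rewrite mulrC /= /GRing.scale/= mulr1 mulrN.
Qed.

Lemma continuous_sinMl (a : R) : continuous (fun x => sin (a * x)).
Proof.
move=> x; apply: (@continuous_comp _ _ _ ( *%R a) sin); first exact: mulrl_continuous.
exact: continuous_sin.
Qed.

Lemma continuous_cosMl (a : R) : continuous (fun x => cos (a * x)).
Proof.
move=> x; apply: (@continuous_comp _ _ _ ( *%R a) cos); first exact: mulrl_continuous.
exact: continuous_cos.
Qed.

Lemma measurable_cos : measurable_fun setT (@cos R).
Proof. by apply: continuous_measurable_fun; exact: continuous_cos. Qed.

Lemma ler_normM_cos (a M x : R) : `|a| <= M -> `|a * cos x| <= M.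
Proof. by move=> aM; rewrite normrM -[leRHS]mulr1 ler_pM// cos_max. Qed.

(* [exp (k z^2 / 2)] is an integrating factor. *)
Lemma is_derive_linear_ode_expR (k : R) (F : R -> R) :
  (forall z : R, is_derive z 1 F (- (k * z * F z))) ->
  forall z, F z = F 0 * expR (- (k * z ^+ 2 / 2)).
Proof.
move=> dF z; pose E : R -> R := expR \o ((k / 2) \*: ((@id R) ^+ 2)).
have dE (x : R) : is_derive x 1 E (k * x * E x).
  by apply: is_derive_eq; rewrite /E /= /GRing.scale/= ?exprfctE mulr1 expr1; lra.
have dFE (x : R) : is_derive x 1 (F * E) 0.
  by apply: is_derive_eq; rewrite /GRing.scale/=; lra.
have : F z * E z = F 0 * E 0 := is_derive_0_is_cst z 0 dFE.
rewrite /E /= exprfctE /GRing.scale/= expr0n/= mulr0 expR0 mulr1 => <-.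
by rewrite expRN [k * _ / 2]mulrAC mulfK// gt_eqF// expR_gt0.
Qed.

Lemma le_continuous_integrable (f g : R -> R) :
  continuous f -> mu.-integrable setT (EFin \o g) -> (forall x, `|f x| <= g x) ->
  mu.-integrable setT (EFin \o f).
Proof.
move=> cf ig fg; apply: (le_integrable measurableT _ _ ig).
  by apply/measurable_EFinP; exact: continuous_measurable_fun.
by move=> x _ /=; rewrite lee_fin (le_trans (fg x))// ler_norm.
Qed.

Lemma normal_peakM (c s : R) : 0 < c -> c * normal_peak (c * s) = normal_peak s.
Proof.
move=> c0; rewrite /normal_peak exprMn -[_ * pi]mulrA -mulrnAr sqrtrM ?sqr_ge0//.
by rewrite sqrtr_sqr gtr0_norm// invfM mulrA divff ?mul1r// gt_eqF.
Qed.

Lemma normal_pdf0E (s x : R) : s != 0 ->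
  normal_pdf 0 s x = normal_peak s * expR (- (x ^+ 2 / (2 * s ^+ 2))).
Proof. by move=> s0; rewrite normal_pdfE// /normal_fun subr0 mulNr mulr_natl. Qed.

Variable s : R.
Hypothesis s_gt0 : 0 < s.
Local Notation p := (normal_pdf 0 s).

Let s_neq0 : s != 0. Proof. by rewrite gt_eqF. Qed.
Let p_ge0 x : 0 <= p x. Proof. exact: normal_pdf_ge0. Qed.
Let cp : continuous p. Proof. exact: continuous_normal_pdf. Qed.

Lemma normal_pdf0N x : p (- x) = p x.
Proof. by rewrite !normal_pdf0E// sqrrN. Qed.

Lemma is_derive_normal_pdf0 (x : R) : is_derive x 1 p (- (x / s ^+ 2) * p x).
Proof.
have -> : p = normal_peak s \*: (expR \o ((- (2 * s ^+ 2)^-1) \*: ((@id R) ^+ 2))).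
  apply/funext => y; rewrite normal_pdf0E//; congr (_ * expR _).
  by rewrite /= exprfctE /GRing.scale/= mulNr mulrC.
apply: is_derive_eq; rewrite /= /GRing.scale/= /= ?exprfctE mulr1 expr1.
by move: (expR _) s_neq0 => e s0; field.
Qed.

Lemma cvg_normal_pdf0 : p x @[x --> +oo] --> 0.
Proof.
have c_gt0 : 0 < (Num.sqrt 2 * s)^-1 by rewrite invr_gt0 mulr_gt0// sqrtr_gt0.
have -> : p = (fun x => normal_peak s * gauss_fun ((Num.sqrt 2 * s)^-1 * x)).
  apply/funext => x; rewrite normal_pdf0E//; congr (_ * expR (- _)).
  by rewrite exprMn exprVn exprMn sqr_sqrtr// mulrC.
rewrite -[X in _ --> X](mulr0 (normal_peak s)); apply: cvgM; first exact: cvg_cst.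
apply: (cvg_comp ( *%R (Num.sqrt 2 * s)^-1) _ _ cvg_gauss_fun).
exact: gt0_cvgMry.
Qed.

(* From [|x| / s <= 1 + (x / 2 s)^2 <= exp ((x / 2 s)^2)]. *)
Lemma normrM_normal_pdf0_le (x : R) :
  `|x| * p x <= Num.sqrt 2 * s * normal_pdf 0 (Num.sqrt 2 * s) x.
Proof.
have sqrt2_gt0 : 0 < Num.sqrt 2 :> R by rewrite sqrtr_gt0.
rewrite !normal_pdf0E ?mulf_neq0 ?gt_eqF// mulrCA.
rewrite [leRHS]mulrACA normal_peakM// exprMn sqr_sqrtr//.
rewrite ler_pM2l ?normal_peak_gt0//.
have -> : expR (- (x ^+ 2 / (2 * (2 * s ^+ 2)))) =
    expR (- (x ^+ 2 / (2 * s ^+ 2))) * expR ((x / (2 * s)) ^+ 2).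
  by rewrite -expRD; congr expR; move: s_neq0 => ?; field.
rewrite [leRHS]mulrCA [leLHS]mulrC ler_pM2l ?expR_gt0//.
apply: (@le_trans _ _ (s * (1 + (x / (2 * s)) ^+ 2))); last first.
  by rewrite ler_pM2l// expR_ge1Dx.
rewrite -subr_ge0 (_ : _ - _ = s * (1 - `|x| / (2 * s)) ^+ 2).
  by rewrite mulr_ge0 ?sqr_ge0 ?ltW.
by rewrite expr_div_n -(real_normK (num_real x)); move: s_neq0 => ?; field.
Qed.

Lemma integrable_normrM_normal_pdf0 :
  mu.-integrable setT (EFin \o (fun x => `|x| * p x)).
Proof.
apply: (@le_continuous_integrable _
  (fun x => Num.sqrt 2 * s * normal_pdf 0 (Num.sqrt 2 * s) x)).
- by move=> x; apply: cvgM; [exact: norm_continuous|exact: cp].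
- exact: (integrableZl measurableT _ (integrable_normal_pdf 0 _)).
- by move=> x; rewrite ger0_norm ?mulr_ge0//; exact: normrM_normal_pdf0_le.
Qed.

Lemma integrable_cosM_normal_pdf0 (a : R) :
  mu.-integrable setT (EFin \o (fun x => cos (a * x) * p x)).
Proof.
apply: le_continuous_integrable (integrable_normal_pdf 0 s) _ => x.
  by apply: cvgM; [exact: continuous_cosMl|exact: cp].
by rewrite normrM (ger0_norm (p_ge0 x)) ler_piMl// cos_max.
Qed.

Lemma continuous_idM_sinM_normal_pdf0 (a : R) :
  continuous (fun x : R => x * sin (a * x) * p x).
Proof.
move=> x; apply: cvgM; last exact: cp.
by apply: cvgM; [exact: cvg_id|exact: continuous_sinMl].
Qed.

Lemma normr_idM_sinM_normal_pdf0_le (a x : R) :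
  `|x * sin (a * x) * p x| <= `|x| * p x.
Proof. by rewrite !normrM (ger0_norm (p_ge0 x)) ler_wpM2r// ler_piMr ?sin_max. Qed.

Lemma integrable_idM_sinM_normal_pdf0 (a : R) :
  mu.-integrable setT (EFin \o (fun x : R => x * sin (a * x) * p x)).
Proof.
apply: le_continuous_integrable integrable_normrM_normal_pdf0 _.
  exact: continuous_idM_sinM_normal_pdf0.
exact: normr_idM_sinM_normal_pdf0_le.
Qed.

Lemma cvg_sinM_normal_pdf0_increment (a : R) :
  sin (a * n%:R) * p n%:R - sin (a * - n%:R) * p (- n%:R) @[n --> \oo] --> 0.
Proof.
apply/norm_cvg0P.
have lim0 : 2 * p n%:R @[n --> \oo] --> 0.
  rewrite -[X in _ --> X](mulr0 2); apply: cvgM; first exact: cvg_cst.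
  exact: cvg_comp cvgr_idn cvg_normal_pdf0.
apply: (squeeze_cvgr _ (cvg_cst 0) lim0); apply: nearW => n.
rewrite normr_ge0/= normal_pdf0N mulrN sinN mulNr opprK -mulrDl normrM.
by rewrite (ger0_norm (p_ge0 _)) ler_wpM2r// (le_trans (ler_normD _ _))// lerD ?sin_max.
Qed.

(* Integration by parts: [x p x = - s^2 p' x]. *)
Lemma Rintegral_idM_sinM_normal_pdf0 (a : R) :
  \int[mu]_x (x * sin (a * x) * p x) =
  s ^+ 2 * a * \int[mu]_x (cos (a * x) * p x).
Proof.
have int_cos := integrableZl measurableT a (integrable_cosM_normal_pdf0 a).
have int_sin :=
  integrableZl measurableT (s ^+ 2)^-1 (integrable_idM_sinM_normal_pdf0 a).
pose f x := a * (cos (a * x) * p x) - (s ^+ 2)^-1 * (x * sin (a * x) * p x).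
have df (x : R) : is_derive x 1 ((fun x => sin (a * x)) * p) (f x).
  apply: (is_derive_eq (is_deriveM (is_derive_sinMl a x) (is_derive_normal_pdf0 x))).
  by rewrite /f /GRing.scale/=; lra.
have cf : continuous f.
  move=> x; apply: cvgB; apply: cvgM; [exact: cvg_cst| |exact: cvg_cst|].
    by apply: cvgM; [exact: continuous_cosMl|exact: cp].
  exact: continuous_idM_sinM_normal_pdf0.
have intf : mu.-integrable setT (EFin \o f) by exact: integrableB int_cos int_sin.
have : \int[mu]_x f x = 0.
  exact: cvg_unique (cvg_symmetric_FTC2 df cf intf) (cvg_sinM_normal_pdf0_increment a).
rewrite (RintegralB measurableT int_cos int_sin) !RintegralZl//; last 2 first.
- exact: integrable_idM_sinM_normal_pdf0.
- exact: integrable_cosM_normal_pdf0.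
move/eqP; rewrite subr_eq0 => /eqP sin_cos.
by rewrite -mulrA sin_cos mulVKf// expf_neq0.
Qed.

Lemma is_derive_cosM_normal_pdf0 (x a : R) :
  is_derive a 1 (fun a => cos (a * x) * p x) (- (x * sin (a * x) * p x)).
Proof.
have -> : (fun a => cos (a * x) * p x) = p x \*: (fun a : R => cos (x * a)).
  by apply/funext => t; rewrite /= /GRing.scale/= mulrC (mulrC t).
apply: (is_derive_eq (is_deriveZ (p x) (is_derive_cosMl x a))).
by rewrite /GRing.scale/= (mulrC a); lra.
Qed.

Lemma is_derive_Rintegral_cosM_normal_pdf0 (z : R) :
  is_derive z 1 (fun a => \int[mu]_x (cos (a * x) * p x))
    (- (s ^+ 2 * z * \int[mu]_x (cos (z * x) * p x))).
Proof.
pose h a x := cos (a * x) * p x.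
have dh a x : partial1of2 h a x = - (x * sin (a * x) * p x).
  by rewrite partial1of2E; have [] := is_derive_cosM_normal_pdf0 x a.
pose I := `]z - 1, z + 1[%classic.
have Iz : I z by rewrite /I/= in_itv/= ltrDl gtrDl ltrN10 ltr01.
have int_h a : I a -> mu.-integrable setT (EFin \o h a).
  by move=> _; exact: integrable_cosM_normal_pdf0.
have der_h a x : I a -> setT x -> derivable (h ^~ x) a 1.
  by move=> _ _; have [] := is_derive_cosM_normal_pdf0 x a.
have dom_ge0 x : 0 <= `|x| * p x by rewrite mulr_ge0.
have dom a x : I a -> setT x -> `|partial1of2 h a x| <= `|x| * p x.
  by move=> _ _; rewrite dh normrN normr_idM_sinM_normal_pdf0_le.
apply: DeriveDef.
  exact: (derivable_under_integral measurableT Iz int_h der_h dom_ge0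
    integrable_normrM_normal_pdf0 dom).
rewrite -derive1E (differentiation_under_integral measurableT Iz int_h der_h
  dom_ge0 integrable_normrM_normal_pdf0 dom).
under eq_Rintegral do rewrite dh -mulN1r.
rewrite RintegralZl ?mulN1r ?Rintegral_idM_sinM_normal_pdf0//.
exact: integrable_idM_sinM_normal_pdf0.
Qed.

Lemma Rintegral_cosM_normal_pdf0 (a : R) :
  \int[mu]_x (cos (a * x) * p x) = expR (- (s ^+ 2 * a ^+ 2 / 2)).
Proof.
rewrite (is_derive_linear_ode_expR is_derive_Rintegral_cosM_normal_pdf0).
under eq_Rintegral do rewrite mul0r cos0 mul1r.
by rewrite /Rintegral integral_normal_pdf mul1r.
Qed.

End normal_Fourier_transform.

Section bounded_integrals.
Context {R : realType}.

Lemma probability_bounded_integrable d (T : measurableType d)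
    (P : probability T R) (f : T -> R) (M : R) :
  measurable_fun setT f -> (forall x, `|f x| <= M) ->
  P.-integrable setT (EFin \o f).
Proof.
move=> mf fM; apply: measurable_bounded_integrable => //.
  by rewrite -ge0_fin_numE// fin_num_measure.
by exists M; split=> [|y My x _]; [exact: num_real|exact: le_trans (fM x) (ltW My)].
Qed.

Lemma Rintegral_fine d (T : measurableType d) (nu : {measure set T -> \bar R})
    (F : T -> \bar R) : measurable_fun setT F ->
  {ae nu, forall x, F x \is a fin_num} ->
  \int[nu]_x fine (F x) = fine (\int[nu]_x F x)%E.
Proof.
move=> mF finF; congr fine; apply: ae_eq_integral => //.
  by apply/measurable_EFinP; exact: measurableT_comp mF.
by apply: filterS finF => x Fx _; rewrite fineK.
Qed.

Lemma Rintegral_Fubini d1 d2 (T1 : measurableType d1) (T2 : measurableType d2)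
    (m1 : {sigma_finite_measure set T1 -> \bar R})
    (m2 : {sigma_finite_measure set T2 -> \bar R}) (f : T1 * T2 -> R) :
  (m1 \x m2)%E.-integrable setT (EFin \o f) ->
  \int[m1]_x \int[m2]_y f (x, y) = \int[m2]_y \int[m1]_x f (x, y).
Proof.
move=> intf; rewrite (Rintegral_fine (measurable_fubini_F intf)); last first.
  by apply: filterS (ae_integrable1 intf) => x; exact: integrable_fin_num.
rewrite (Rintegral_fine (measurable_fubini_G intf)); last first.
  by apply: filterS (ae_integrable2 intf) => y; exact: integrable_fin_num.
by rewrite -(Fubini intf).
Qed.

Lemma Rintegral_law d1 d2 (T1 : measurableType d1) (T2 : measurableType d2)
    (P : probability T1 R) (Q : probability T2 R) (Y : T1 -> T2) (f : T2 -> R)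
    (M : R) :
  measurable_fun setT Y -> (forall B, measurable B -> P (Y @^-1` B) = Q B) ->
  measurable_fun setT f -> (forall x, `|f x| <= M) ->
  \int[P]_w f (Y w) = \int[Q]_x f x.
Proof.
move=> mY lawY mf fM.
have mfE : measurable_fun setT (EFin \o f) by exact/measurable_EFinP.
have intfY : P.-integrable setT (EFin \o f \o Y).
  exact: probability_bounded_integrable (measurableT_comp mf mY) (fun w => fM (Y w)).
rewrite /Rintegral -[X in fine X = _](integral_pushforward mY mfE intfY measurableT).
by congr fine; apply: eq_measure_integral => B mB _; exact: lawY.
Qed.

End bounded_integrals.

Section normal_law.
Context {R : realType}.
Local Notation mu := (@lebesgue_measure R).

Lemma integral_normal_prob (m s : R) (f : R -> \bar R) :
  (normal_prob m s).-integrable setT f ->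
  (\int[normal_prob m s]_x f x = \int[mu]_x (f x * (normal_pdf m s x)%:E))%E.
Proof.
move=> intf; have mf : measurable_fun setT f by case/integrableP: intf.
have dom := @normal_prob_dominates R m s.
have mpdf : measurable_fun setT (fun x => (normal_pdf m s x)%:E).
  by apply/measurable_EFinP; exact: measurable_normal_pdf.
rewrite -(Radon_Nikodym_change_of_variables dom)//=.
apply: ae_eq_integral => //.
- exact: emeasurable_funM.
- exact: emeasurable_funM.
- apply: ae_eqe_mul2l; apply: integral_ae_eq => //=.
  + exact: Radon_Nikodym_integrable.
  + by move=> B _ mB; rewrite -Radon_Nikodym_integral.
Qed.

Lemma Rintegral_normal_prob (m s : R) (f : R -> R) :
  (normal_prob m s).-integrable setT (EFin \o f) ->
  \int[normal_prob m s]_x f x = \int[mu]_x (f x * normal_pdf m s x).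
Proof. by move=> intf; rewrite /Rintegral integral_normal_prob. Qed.

Lemma Rintegral_cosM_normal_prob0 (s a : R) : 0 < s ->
  \int[normal_prob 0 s]_x cos (a * x) = expR (- (s ^+ 2 * a ^+ 2 / 2)).
Proof.
move=> s_gt0; rewrite -Rintegral_cosM_normal_pdf0// Rintegral_normal_prob//.
apply: (probability_bounded_integrable _ (M := 1)) => [|x].
  by apply: continuous_measurable_fun; exact: continuous_cosMl.
exact: cos_max.
Qed.

Lemma gauss_fun_Rintegral_cos (y : R) :
  gauss_fun y = \int[normal_prob 0 (Num.sqrt 2)]_u cos (y * u).
Proof.
by rewrite Rintegral_cosM_normal_prob0 ?sqrtr_gt0// sqr_sqrtr// mulrAC divff// mul1r.
Qed.

Lemma expR_Nsqr_le1 (v x : R) : 0 <= v -> `|expR (- (v * x ^+ 2 / 2))| <= 1.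
Proof.
move=> v_ge0; rewrite ger0_norm ?expR_ge0// -expR0 ler_expR oppr_le0.
by rewrite divr_ge0// mulr_ge0// sqr_ge0.
Qed.

Lemma measurable_expR_Nsqr (v : R) :
  measurable_fun setT (fun x : R => expR (- (v * x ^+ 2 / 2))).
Proof.
apply: measurableT_comp => //; apply: measurableT_comp => //.
by apply: measurable_funM => //; exact: measurable_funM.
Qed.

Lemma expR_NsqrM_normal_pdf0 (s v x : R) : 0 < s -> 0 <= v ->
  let k := Num.sqrt (1 + s ^+ 2 * v) in
  expR (- (v * x ^+ 2 / 2)) * normal_pdf 0 s x = k^-1 * normal_pdf 0 (s / k) x.
Proof.
move=> s_gt0 v_ge0 k; have s_neq0 : s != 0 by rewrite gt_eqF.
have k_gt0 : 0 < k by rewrite sqrtr_gt0 ltr_pwDl// mulr_ge0// sqr_ge0.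
have k_neq0 : k != 0 by rewrite gt_eqF.
have k2 : k ^+ 2 = 1 + s ^+ 2 * v by rewrite sqr_sqrtr// addr_ge0// mulr_ge0// sqr_ge0.
rewrite !normal_pdf0E ?mulf_neq0 ?invr_neq0// mulrCA -expRD mulrA; congr (_ * expR _).
  by rewrite [s / k]mulrC normal_peakM// invr_gt0.
by rewrite expr_div_n k2; field; rewrite s_neq0 -k2 expf_neq0.
Qed.

Lemma Rintegral_expR_Nsqr_normal_prob0 (s v : R) : 0 < s -> 0 <= v ->
  \int[normal_prob 0 s]_x expR (- (v * x ^+ 2 / 2)) =
  (Num.sqrt (1 + s ^+ 2 * v))^-1.
Proof.
move=> s_gt0 v_ge0; rewrite Rintegral_normal_prob; last first.
  apply: (probability_bounded_integrable _ (M := 1)).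
    exact: measurable_expR_Nsqr.
  by move=> x; exact: expR_Nsqr_le1.
under eq_Rintegral do rewrite expR_NsqrM_normal_pdf0//.
rewrite RintegralZl//; last exact: integrable_normal_pdf.
by rewrite /Rintegral integral_normal_pdf mulr1.
Qed.

Lemma Rintegral_cos_centered_gaussian d (T : measurableType d)
    (P : probability T R) (Y : T -> R) (v : R) : 0 <= v ->
  centered_gaussian P Y v -> \int[P]_w cos (Y w) = expR (- (v / 2)).
Proof.
move=> v_ge0 [mY lawY].
have [v0|v_neq0] := eqVneq v 0.
  rewrite (Rintegral_law (Q := \d_(0 : R)) mY _ measurable_cos (@cos_max R)).
    rewrite /Rintegral integral_dirac//=; last first.
      by apply/measurable_EFinP; exact: measurable_cos.
    by rewrite indicT mul1r cos0 v0 mul0r oppr0 expR0.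
  by move=> B mB; rewrite lawY// v0 eqxx.
rewrite (Rintegral_law (Q := normal_prob 0 (Num.sqrt v)) mY _ measurable_cos
  (@cos_max R)); last by move=> B mB; rewrite lawY// (negbTE v_neq0).
have := @Rintegral_cosM_normal_prob0 (Num.sqrt v) 1.
rewrite sqr_sqrtr// expr1n mulr1 sqrtr_gt0 lt0r v_neq0 v_ge0 => <- //.
by apply: eq_Rintegral => x _; rewrite mul1r.
Qed.

End normal_law.

Section gaussian_kernel_expectation.
Context {R : realType} d (T : measurableType d) (P : probability T R).

Lemma bounded_cosM_integrable (H S : T -> R) (M : R) :
  measurable_fun setT H -> measurable_fun setT S -> (forall w, `|H w| <= M) ->
  P.-integrable setT (EFin \o (fun w => H w * cos (S w))).
Proof.
move=> mH mS HM; apply: (probability_bounded_integrable P (M := M)) => [|w].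
  by apply: measurable_funM => //; exact: measurableT_comp measurable_cos mS.
exact: ler_normM_cos.
Qed.

Lemma Rintegral_gauss_fun_Fourier (H Y : T -> R) (M : R) :
  measurable_fun setT H -> measurable_fun setT Y -> (forall w, `|H w| <= M) ->
  \int[P]_w (H w * gauss_fun (Y w)) =
  \int[normal_prob 0 (Num.sqrt 2)]_u \int[P]_w (H w * cos (u * Y w)).
Proof.
move=> mH mY HM; pose f (z : T * measurableTypeR R) := H z.1 * cos (z.2 * Y z.1).
have intf : (P \x normal_prob 0 (Num.sqrt 2))%E.-integrable setT (EFin \o f).
  apply: (probability_bounded_integrable _ (M := M)) => [|z].
    apply: measurable_funM; first exact: measurableT_comp mH measurable_fst.
    apply: measurableT_comp measurable_cos _.
    apply: measurable_funM; first exact: measurable_snd.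
    exact: measurableT_comp mY measurable_fst.
  exact: ler_normM_cos.
rewrite -(Rintegral_Fubini intf); apply: eq_Rintegral => w _.
rewrite gauss_fun_Rintegral_cos -RintegralZl//.
  by apply: eq_Rintegral => u _; rewrite /f/= [u * _]mulrC.
apply: (probability_bounded_integrable _ (M := 1)) => [|u]; last exact: cos_max.
by apply: continuous_measurable_fun; exact: continuous_cosMl.
Qed.

Lemma Rintegral_cosM_cos (H Y S : T -> R) (M : R) :
  measurable_fun setT H -> measurable_fun setT Y -> measurable_fun setT S ->
  (forall w, `|H w| <= M) ->
  \int[P]_w (H w * cos (S w) * cos (Y w)) =
  2^-1 * (\int[P]_w (H w * cos (S w + Y w)) + \int[P]_w (H w * cos (S w - Y w))).
Proof.
move=> mH mY mS HM.
have intD := bounded_cosM_integrable mH (measurable_funD mS mY) HM.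
have intB := bounded_cosM_integrable mH (measurable_funB mS mY) HM.
rewrite -(RintegralD measurableT intD intB) -RintegralZl//; last first.
  exact: integrableD intD intB.
by apply: eq_Rintegral => w _; rewrite cosD cosB; lra.
Qed.

Variable v : R.
Hypothesis v_ge0 : 0 <= v.

Lemma Rintegral_gauss_funM (H Y S : T -> R) (M a : R) :
  measurable_fun setT H -> measurable_fun setT Y -> measurable_fun setT S ->
  (forall w, `|H w| <= M) ->
  (forall u, \int[P]_w (H w * cos (S w + u * Y w)) = a * expR (- (v * u ^+ 2 / 2))) ->
  \int[P]_w (H w * gauss_fun (Y w) * cos (S w)) = a / Num.sqrt (1 + 2 * v).
Proof.
move=> mH mY mS HM charY; under eq_Rintegral do rewrite mulrAC.
rewrite (Rintegral_gauss_fun_Fourier (M := M))//; last 2 first.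
- by apply: measurable_funM => //; exact: measurableT_comp measurable_cos mS.
- by move=> w; exact: ler_normM_cos.
transitivity (\int[normal_prob 0 (Num.sqrt 2)]_u (a * expR (- (v * u ^+ 2 / 2)))).
  apply: eq_Rintegral => u _.
  rewrite (Rintegral_cosM_cos (Y := fun w => u * Y w) (M := M))//; last first.
    exact: measurable_funM.
  under [X in _ + X]eq_Rintegral do rewrite -mulNr.
  by rewrite !charY sqrrN; lra.
rewrite RintegralZl//; last first.
  apply: (probability_bounded_integrable _ (M := 1)); first exact: measurable_expR_Nsqr.
  by move=> u; exact: expR_Nsqr_le1.
by rewrite Rintegral_expR_Nsqr_normal_prob0 ?sqrtr_gt0// sqr_sqrtr.
Qed.

Lemma measurable_prod_gauss_fun n (Y : 'I_n -> T -> R) :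
  (forall i, measurable_fun setT (Y i)) ->
  measurable_fun setT (fun w => \prod_(i < n) gauss_fun (Y i w)).
Proof.
move=> mY; apply: measurable_prod => i _.
exact: measurableT_comp measurable_gauss_fun _.
Qed.

(* The weight [H] and the phase [S] are what the induction on [n] needs: peeling
   off [Y ord0] turns its kernel into a weight and moves the other [Y i] to the
   phase. *)
Lemma Rintegral_prod_gauss_funM n (Y : 'I_n -> T -> R) (H S : T -> R) (M a : R) :
  measurable_fun setT H -> (forall i, measurable_fun setT (Y i)) ->
  measurable_fun setT S -> (forall w, `|H w| <= M) ->
  (forall c : 'I_n -> R,
    \int[P]_w (H w * cos (S w + \sum_(i < n) c i * Y i w)) =
    a * expR (- (v * (\sum_(i < n) c i ^+ 2) / 2))) ->
  \int[P]_w (H w * (\prod_(i < n) gauss_fun (Y i w)) * cos (S w)) =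
    a / Num.sqrt (1 + 2 * v) ^+ n.
Proof.
elim: n Y H S M a => [|n IH] Y H S M a mH mY mS HM charY.
  have := charY (fun=> 0); rewrite big_ord0 mulr0 mul0r oppr0 expR0 mulr1 divr1 => <-.
  by apply: eq_Rintegral => w _; rewrite !big_ord0 mulr1 addr0.
rewrite exprS invfM mulrA.
rewrite -(IH (fun i => Y (lift ord0 i)) (fun w => H w * gauss_fun (Y ord0 w)) S M)//.
- by apply: eq_Rintegral => w _; rewrite big_ord_recl/= !mulrA.
- by apply: measurable_funM => //; exact: measurableT_comp measurable_gauss_fun _.
- move=> w; rewrite normrM -[leRHS]mulr1 ler_pM// ger0_norm ?gauss_fun_ge0//.
  exact: gauss_fun_le1.
move=> c; rewrite mulrAC; apply: (Rintegral_gauss_funM (M := M)) => //.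
  apply: measurable_funD => //; apply: measurable_sum => i.
  exact: measurable_funM.
move=> u; have := charY (fun i => if unlift ord0 i is Some j then c j else u).
rewrite big_ord_recl unlift_none; under eq_bigr do rewrite liftK.
rewrite mulrDr mulrDl opprD expRD mulrA mulrAC => <-.
apply: eq_Rintegral => w _; rewrite big_ord_recl unlift_none addrA addrAC.
by under [in RHS]eq_bigr do rewrite liftK.
Qed.

Lemma Rintegral_prod_gauss_fun n (Y : 'I_n -> T -> R) :
  (forall i, measurable_fun setT (Y i)) ->
  (forall c : 'I_n -> R, \int[P]_w cos (\sum_(i < n) c i * Y i w) =
    expR (- (v * (\sum_(i < n) c i ^+ 2) / 2))) ->
  \int[P]_w \prod_(i < n) gauss_fun (Y i w) = (Num.sqrt (1 + 2 * v) ^+ n)^-1.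
Proof.
move=> mY charY; rewrite -[RHS]mul1r.
rewrite -(Rintegral_prod_gauss_funM (H := cst 1) (S := cst 0) (M := 1) _ mY)//.
- by apply: eq_Rintegral => w _; rewrite mul1r cos0 mulr1.
- by move=> w; rewrite normr1.
- by move=> c; rewrite mul1r -charY; apply: eq_Rintegral => w _; rewrite mul1r add0r.
Qed.

End gaussian_kernel_expectation.

Section increment_kernel.
Context {R : realType} {d : nat}.
Implicit Types (f : R -> 'rV[R]_d) (rho t s : R).

Definition increment_kernel f rho t s : R :=
  \prod_(i < d) gauss_fun ((f t ord0 i - f s ord0 i) / rho).

Lemma increment_kernel_diag f rho t : increment_kernel f rho t t = 1.
Proof.
by apply: big1 => i _; rewrite subrr mul0r /gauss_fun expr0n oppr0 expR0.
Qed.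

Lemma increment_kernel_ge0 f rho t s : 0 <= increment_kernel f rho t s.
Proof. by apply: prodr_ge0 => i _; exact: gauss_fun_ge0. Qed.

Lemma increment_kernel_le1 f rho t s : increment_kernel f rho t s <= 1.
Proof. by apply: prodr_ile1 => i _; rewrite gauss_fun_ge0 gauss_fun_le1. Qed.

Lemma ler_gauss_fun (x y : R) : `|x| <= y -> gauss_fun y <= gauss_fun x.
Proof.
move=> xy; rewrite ler_expR lerN2 -[leLHS](real_normK (num_real x)).
by rewrite lerXn2r// nnegrE// (le_trans _ xy).
Qed.

Lemma increment_kernel_ge f rho t s (c : R) : 0 < rho ->
  (forall i, `|f t ord0 i - f s ord0 i| <= c * rho) ->
  gauss_fun c ^+ d <= increment_kernel f rho t s.
Proof.
move=> rho_gt0 close; rewrite -[d in _ ^+ d]card_ord -prodr_const.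
apply: ler_prod => i _; rewrite gauss_fun_ge0 ler_gauss_fun//.
by rewrite normrM normfV (gtr0_norm rho_gt0) ler_pdivrMr.
Qed.

Lemma inv_sqrt1D_le (u rho : R) : 0 < u -> 0 < rho ->
  (Num.sqrt (1 + 2 * (u ^+ 2 / rho ^+ 2)))^-1 <= rho / u.
Proof.
move=> u_gt0 rho_gt0.
rewrite -[leRHS]invf_div lef_pV2 ?posrE ?divr_gt0// ?sqrtr_gt0; last first.
  by rewrite ltr_wpDr// mulr_ge0// divr_ge0 ?sqr_ge0.
rewrite -[leLHS]ger0_norm; last by rewrite divr_ge0// ltW.
rewrite -sqrtr_sqr ler_wsqrtr// expr_div_n.
have : 0 <= u ^+ 2 / rho ^+ 2 by rewrite divr_ge0 ?sqr_ge0.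
lra.
Qed.

End increment_kernel.

Section fbm_increments.
Context {R : realType} dT (T : measurableType dT) (P : probability T R).
Variables (d : nat) (alpha : R) (X : R -> T -> 'rV[R]_d).
Hypotheses (alpha_gt0 : 0 < alpha) (fbmX : is_fbm P alpha X).

Lemma fbm_cov_increment (t s : R) :
  fbm_cov alpha t t - fbm_cov alpha t s - fbm_cov alpha s t + fbm_cov alpha s s =
  `|t - s| `^ (2 * alpha).
Proof.
rewrite /fbm_cov !subrr normr0 powR0 ?mulf_neq0 ?gt_eqF// (distrC s t); lra.
Qed.

Lemma measurable_fbm t i : measurable_fun setT (fun w => X t w ord0 i).
Proof.
have [+ _] := fbmX.1 1%N (fun=> t) (fun=> i) (fun=> 1).
by under eq_fun do rewrite big_ord1 mul1r.
Qed.

Lemma fbm_increment_gaussian (t s : R) (c : 'I_d -> R) :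
  centered_gaussian P
    (fun w => \sum_(i < d) c i * (X t w ord0 i - X s w ord0 i))
    ((\sum_(i < d) c i ^+ 2) * `|t - s| `^ (2 * alpha)).
Proof.
have splitl i : fintype.split (lshift d i) = inl i := unsplitK (inl i).
have splitr i : fintype.split (rshift d i) = inr i := unsplitK (inr i).
pose ts (k : 'I_(d + d)) := if fintype.split k is inl _ then t else s.
pose ix (k : 'I_(d + d)) := match fintype.split k with inl i | inr i => i end.
pose cs (k : 'I_(d + d)) :=
  match fintype.split k with inl i => c i | inr i => - c i end.
have := fbmX.1 _ ts ix cs; congr centered_gaussian.
  apply/funext => w; rewrite big_split_ord/= -big_split/=; apply: eq_bigr => i _.
  by rewrite /ts /ix /cs splitl splitr mulrBr mulNr.
rewrite big_split_ord/= -big_split/= mulr_suml; apply: eq_bigr => i _.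
transitivity (\sum_(j < d | j == i) c i * c j * `|t - s| `^ (2 * alpha)); last first.
  by rewrite big_pred1_eq.
rewrite [RHS]big_mkcond !big_split_ord/= -!big_split/=; apply: eq_bigr => j _.
rewrite /ts /ix /cs !splitl !splitr -fbm_cov_increment eq_sym.
by case: eqP => _; ring.
Qed.

Lemma measurable_increment_kernel (t s rho : R) :
  measurable_fun setT (fun w => increment_kernel (X ^~ w) rho t s).
Proof.
apply: measurable_prod_gauss_fun => i; apply: measurable_funM => //.
by apply: measurable_funB; exact: measurable_fbm.
Qed.

(* Only the laws of linear combinations are given; they determine this
   expectation through the Fourier representation of the kernel, without the
   joint density. *)
Lemma Rintegral_increment_kernel (t s rho : R) :
  \int[P]_w increment_kernel (X ^~ w) rho t s =
  (Num.sqrt (1 + 2 * (`|t - s| `^ (2 * alpha) / rho ^+ 2)) ^+ d)^-1.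
Proof.
apply: Rintegral_prod_gauss_fun => [|i|c].
- by rewrite divr_ge0 ?powR_ge0 ?sqr_ge0.
- by apply: measurable_funM => //; apply: measurable_funB; exact: measurable_fbm.
have gaussX := fbm_increment_gaussian t s (fun i => c i / rho).
rewrite (_ : _ * \sum_(i < d) c i ^+ 2 =
    (\sum_(i < d) (c i / rho) ^+ 2) * `|t - s| `^ (2 * alpha)); last first.
  rewrite mulrAC -mulrA mulrC mulr_suml; congr (_ * _).
  by apply: eq_bigr => i _; rewrite expr_div_n.
rewrite -(Rintegral_cos_centered_gaussian _ gaussX); last first.
  by rewrite mulr_ge0 ?powR_ge0// sumr_ge0// => i _; exact: sqr_ge0.
apply: eq_Rintegral => w _; congr cos; apply: eq_bigr => i _.
by rewrite mulrA mulrAC.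
Qed.

Lemma Rintegral_increment_kernel_le (t s rho : R) : t != s -> 0 < rho ->
  \int[P]_w increment_kernel (X ^~ w) rho t s <=
  rho ^+ d * `|t - s| `^ (- (alpha * d%:R)).
Proof.
move=> ts rho_gt0; have x_gt0 : 0 < `|t - s| by rewrite normr_gt0 subr_eq0.
rewrite Rintegral_increment_kernel.
have -> : `|t - s| `^ (2 * alpha) = (`|t - s| `^ alpha) ^+ 2.
  by rewrite mulrC powRrM powR_mulrn// powR_ge0.
rewrite powRN powRrM powR_mulrn ?powR_ge0// -[(_ `^ _ ^+ d)^-1]exprVn -exprMn -exprVn.
apply: lerXn2r; rewrite ?nnegrE ?invr_ge0 ?sqrtr_ge0//.
  by rewrite divr_ge0 ?powR_ge0 ?ltW.
by apply: inv_sqrt1D_le; rewrite ?powR_gt0.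
Qed.

Lemma integral_increment_kernel (t s rho : R) :
  (\int[P]_w (increment_kernel (X ^~ w) rho t s)%:E =
   (\int[P]_w increment_kernel (X ^~ w) rho t s)%:E)%E.
Proof.
rewrite fineK//; apply: integrable_fin_num => //.
apply: (probability_bounded_integrable P (M := 1)).
  exact: measurable_increment_kernel.
by move=> w; rewrite ger0_norm ?increment_kernel_ge0 ?increment_kernel_le1.
Qed.

End fbm_increments.

Section power_sums.
Context {R : realType}.

Lemma powR_le1 (r b : R) : 0 < r <= 1 -> 0 <= b -> r `^ b <= 1.
Proof. by move=> r01 b_ge0; rewrite -(powRr0 r) ger_powR. Qed.

Lemma powR_lt1 (r b : R) : 0 < r < 1 -> 0 < b -> r `^ b < 1.
Proof.
move=> /andP[r_gt0 r_lt1] b_gt0; have := gt0_ltr_powR b_gt0.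
by move=> /(_ r 1); rewrite powR1 !nnegrE ltW// ler01 => ->.
Qed.

Lemma powR_Bernoulli (z p : R) : 0 <= z -> 0 < p < 1 -> z `^ p <= 1 - p + p * z.
Proof.
move=> z_ge0 /andP[p_gt0 p_lt1]; have q_gt0 : 0 < 1 - p by rewrite subr_gt0.
have := @conjugate_powR R (z `^ p) 1 p^-1 (1 - p)^-1 (powR_ge0 _ _) ler01.
rewrite !invr_gt0 !invrK -powRrM divff ?gt_eqF// powRr1// powR1 mul1r mulr1.
by move=> /(_ p_gt0 q_gt0); rewrite addrC subrK => /(_ erefl); rewrite addrC mulrC.
Qed.

(* Bernoulli's inequality at [z = n / (n + 1)]. *)
Lemma powRS_increment_ge (a : R) n : 0 < a < 1 ->
  (1 - a) * n.+1%:R `^ (- a) <= n.+1%:R `^ (1 - a) - n%:R `^ (1 - a).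
Proof.
move=> /andP[a_gt0 a_lt1].
have n1_gt0 : 0 < n.+1%:R :> R by [].
have z_ge0 : 0 <= n%:R / n.+1%:R :> R by rewrite divr_ge0.
have q01 : 0 < 1 - a < 1 by rewrite subr_gt0 a_lt1 gtrBl.
have -> : n.+1%:R `^ (- a) = n.+1%:R `^ (1 - a) / n.+1%:R :> R.
  by rewrite powRB ?gt_eqF ?implybT// powRr1// powRN mulrAC divff ?mul1r// gt_eqF.
have -> : n%:R `^ (1 - a) = n.+1%:R `^ (1 - a) * (n%:R / n.+1%:R) `^ (1 - a) :> R.
  by rewrite -powRM// mulrCA divff ?mulr1// gt_eqF.
rewrite mulrCA -[X in _ <= X - _]mulr1 -mulrBr ler_pM2l ?powR_gt0//.
rewrite lerBrDr (le_trans (lerD (lexx _) (powR_Bernoulli z_ge0 q01)))//.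
rewrite [leLHS](_ : _ = 1)//; move: n1_gt0; rewrite -natr1 => n1_gt0.
by field; rewrite gt_eqF.
Qed.

Lemma sum_powRN_le (a : R) n : 0 < a < 1 ->
  \sum_(k < n) k.+1%:R `^ (- a) <= n%:R `^ (1 - a) / (1 - a).
Proof.
move=> a01; have q_gt0 : 0 < 1 - a by case/andP: a01 => _; rewrite subr_gt0.
rewrite ler_pdivlMr// mulrC; elim: n => [|n IH].
  by rewrite big_ord0 mulr0 powR_ge0.
rewrite big_ord_recr/= mulrDr -lerBrDl (le_trans (powRS_increment_ge n a01))//.
by rewrite lerB.
Qed.

Lemma sum_eq_nat_le1 n (c : nat) : \sum_(j < n) (j == c :> nat)%:R <= 1 :> R.
Proof.
under eq_bigr do rewrite mulrb; rewrite -big_mkcond/= sumr_const lern1.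
by apply/card_le1_eqP => i j /eqP ic /eqP jc; apply: val_inj; rewrite /= ic jc.
Qed.

Lemma sum_distn_le (h : nat -> R) n m (i : 'I_n) (Q : pred 'I_n) :
  (forall k, 0 <= h k) -> (forall j, Q j -> `|i - j| <= m)%N ->
  \sum_(j < n | Q j && (j != i)) h `|i - j|%N <= 2 * \sum_(k < m) h k.+1.
Proof.
move=> h_ge0 Qm.
pose at_dist (j k : nat) : R := (j == (i + k)%N)%:R + (j == (i - k)%N)%:R.
apply: (@le_trans _ _ (\sum_(j < n) \sum_(k < m) h k.+1 * at_dist j k.+1)).
  rewrite big_mkcond/=; apply: ler_sum => j _.
  have term_ge0 k : 0 <= h k * at_dist j k by rewrite mulr_ge0// addr_ge0.
  case: ifPn => [/andP[Qj ji]|_]; last by apply: sumr_ge0.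
  case dist_ij : `|i - j|%N (Qm _ Qj) => [|k] km.
    move/eqP: dist_ij; rewrite distn_eq0 eq_sym => /eqP/val_inj ij.
    by rewrite ij eqxx in ji.
  rewrite (bigD1 (Ordinal km))//= ler_wpDr//; first by apply: sumr_ge0.
  rewrite ler_peMr// /at_dist; move: dist_ij.
  case: (leqP i j) => [ij|/ltnW ij].
    by rewrite distnEr// => <-; rewrite subnKC// eqxx lerDl.
  by rewrite distnEl// => <-; rewrite subKn// eqxx lerDr.
rewrite exchange_big/= mulr_sumr; apply: ler_sum => k _.
rewrite -mulr_sumr mulrC ler_wpM2r// /at_dist big_split/=.
by rewrite (_ : 2 = 1 + 1)// lerD// sum_eq_nat_le1.
Qed.

Lemma sqr_sum_le m (f : 'I_m -> R) : (\sum_k f k) ^+ 2 <= m%:R * \sum_k f k ^+ 2.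
Proof.
have <- : \sum_(k < m) \sum_(l < m) (f k ^+ 2 + f l ^+ 2) / 2 = m%:R * \sum_k f k ^+ 2.
  under eq_bigr do rewrite -mulr_suml big_split/= sumr_const card_ord.
  rewrite -mulr_suml big_split/= sumr_const card_ord sumrMnl -mulr_natl; lra.
rewrite expr2 mulr_suml; apply: ler_sum => k _; rewrite mulr_sumr.
apply: ler_sum => l _; have := sqr_ge0 (f k - f l); lra.
Qed.

Lemma sqr_card_le_fibre_pairs n m (c : 'I_n -> 'I_m) :
  n%:R ^+ 2 <= m%:R * \sum_(i < n) \sum_(j < n) (c i == c j)%:R :> R.
Proof.
pose f (k : 'I_m) : R := \sum_(i < n) (c i == k)%:R.
have sum_pick i (g : 'I_m -> R) : \sum_k (c i == k)%:R * g k = g (c i).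
  rewrite (bigD1 (c i))//= eqxx mul1r big1 ?addr0// => k.
  by rewrite eq_sym => /negbTE ->; rewrite mul0r.
have <- : \sum_k f k = n%:R.
  rewrite exchange_big/= -[n in RHS]card_ord -sumr_const; apply: eq_bigr => i _.
  by under eq_bigr do rewrite -[_%:R]mulr1; rewrite (sum_pick i (cst 1)).
have -> : \sum_(i < n) \sum_(j < n) (c i == c j)%:R = \sum_k f k ^+ 2.
  under [RHS]eq_bigr do rewrite expr2 mulr_suml.
  rewrite [RHS]exchange_big/=; apply: eq_bigr => i _; rewrite sum_pick.
  by apply: eq_bigr => j _; rewrite eq_sym.
exact: sqr_sum_le.
Qed.

End power_sums.

Section spaced_points.
Context {R : realType}.

Definition spaced (r : R) (n : nat) (x : nat -> R) :=
  forall i j, (i < j < n)%N -> r * (j - i)%:R <= x j - x i.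

Lemma spaced_dist_ge (r : R) n (x : nat -> R) i j : spaced r n x ->
  (i < n)%N -> (j < n)%N -> r * `|i - j|%N%:R <= `|x i - x j|.
Proof.
move=> xr ni nj; case: (ltngtP i j) => [ij|ij|->].
- by rewrite distnEr 1?ltnW// distrC (le_trans _ (ler_norm _))// xr// ij.
- by rewrite distnEl 1?ltnW// (le_trans _ (ler_norm _))// xr// ij.
- by rewrite distnn mulr0.
Qed.

Lemma spaced_neq (r : R) n (x : nat -> R) i j : 0 < r -> spaced r n x ->
  (i < n)%N -> (j < n)%N -> i != j -> x i != x j.
Proof.
move=> r_gt0 xr ni nj ij; rewrite -subr_eq0 -normr_gt0.
by rewrite (lt_le_trans _ (spaced_dist_ge xr ni nj))// mulr_gt0// ltr0n lt0n distn_eq0.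
Qed.

Lemma sum_spaced_le (x : nat -> R) (r a : R) n m (i : 'I_n) (Q : pred 'I_n) :
  0 < r -> 0 < a < 1 -> spaced r n x -> (forall j, Q j -> `|i - j| <= m)%N ->
  \sum_(j < n | Q j && (j != i)) `|x i - x j| `^ (- a) <=
  2 * (r `^ (- a) * (m%:R `^ (1 - a) / (1 - a))).
Proof.
move=> r_gt0 a01 xr Qm; have a_gt0 : 0 < a by case/andP: a01.
apply: (@le_trans _ _
    (\sum_(j < n | Q j && (j != i)) r `^ (- a) * `|i - j|%N%:R `^ (- a))).
  apply: ler_sum => j /andP[_ ji].
  have dist_gt0 : 0 < r * `|i - j|%N%:R.
    by rewrite mulr_gt0// ltr0n lt0n distn_eq0 eq_sym.
  have le_dist := spaced_dist_ge xr (ltn_ord i) (ltn_ord j).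
  rewrite -(powRM _ (ltW r_gt0) (ler0n _ _)) !powRN.
  rewrite lef_pV2 ?posrE ?powR_gt0 ?(lt_le_trans dist_gt0)//.
  by apply: ge0_ler_powR; rewrite ?nnegrE// ltW.
rewrite -mulr_sumr mulrCA ler_pM2l ?powR_gt0//.
apply: (le_trans (sum_distn_le (h := fun k => k%:R `^ (- a)) _ Qm)).
  by move=> k; exact: powR_ge0.
by rewrite ler_pM2l// sum_powRN_le.
Qed.

Lemma sorted_spaced (r : R) (s : seq R) :
  sorted <=%R s -> uniq s -> {in s &, forall x y, x != y -> r <= `|x - y|} ->
  spaced r (size s) (nth 0 s).
Proof.
move=> sorted_s uniq_s sep i j /andP[]; elim: j => // j IH; rewrite ltnS => ij js.
have gap : r <= nth 0 s j.+1 - nth 0 s j.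
  rewrite -[leRHS]ger0_norm; last first.
    rewrite subr_ge0; apply: (sorted_leq_nth le_trans le_refl) => //.
    by rewrite inE ltnW.
  apply: sep; [exact: mem_nth|exact/mem_nth/ltnW|].
  by rewrite nth_uniq ?(ltnW js)// gtn_eqF.
move: ij; rewrite leq_eqVlt => /predU1P[->|ij]; first by rewrite subSnn mulr1.
have := IH ij (ltnW js); rewrite subSn 1?ltnW// -natr1 mulrDr mulr1; lra.
Qed.

End spaced_points.

Section box_dimension.
Context {R : realType} {V : pseudoMetricType R}.
Implicit Types (E : set V) (r b : R).

Lemma covering_number_ge0 E r : (0 <= covering_number E r)%E.
Proof. by apply/le_ereal_inf_tmp => _ [n _ <-]; rewrite lee_fin. Qed.

Lemma covering_number_le E r n (c : 'I_n -> V) :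
  E `<=` \bigcup_(i in setT) ball (c i) r -> (covering_number E r <= n%:R%:E)%E.
Proof. by move=> Ec; apply: ereal_inf_lbound; exists n => //; exists c. Qed.

Lemma covering_number_gt_separated E r n : 0 < r -> (n%:R%:E < covering_number E r)%E ->
  exists s : seq V, [/\ size s = n.+1, uniq s, {in s, forall x, E x} &
    {in s &, forall x y, x != y -> ~ ball x r y}].
Proof.
move=> r_gt0.
have extend (s : seq V) : ((size s)%:R%:E < covering_number E r)%E ->
    exists2 y, E y & {in s, forall x, ~ ball x r y}.
  move=> cov; apply: contrapT => stuck; move: cov; apply/negP; rewrite -leNgt.
  apply: (covering_number_le (c := tnth (in_tuple s))) => y Ey.
  have [x xs xy] : exists2 x, x \in s & ball x r y.
    apply: contrapT => far; apply: stuck; exists y => // x xs xy.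
    by apply: far; exists x.
  by have /tnthP[i xi] : x \in in_tuple s by []; exists i => //; rewrite -xi.
elim: n => [|n IH] cov.
  have [y Ey _] := extend [::] cov.
  exists [:: y]; split=> // [x|x z]; first by rewrite inE => /eqP ->.
  by rewrite !inE => /eqP -> /eqP ->; rewrite eqxx.
have [|s [sz uniq_s sE sep]] := IH.
  by apply: lt_trans cov; rewrite lte_fin ltr_nat.
have [|y Ey far] := extend s; first by rewrite sz.
have yNs : y \notin s by apply/negP => /far; apply; exact: ballxx.
exists (y :: s); split=> /=; [by rewrite sz|by rewrite yNs| |].
- by move=> x /[!inE] /predU1P[->//|/sE].
- move=> x z /[!inE] /predU1P[->|xs] /predU1P[->|zs]; rewrite ?eqxx// => xz.
  + by move=> /ball_sym; exact: far.
  + exact: far.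
  + exact: sep.
Qed.

Lemma box_ratio_gt E r b : 0 < r < 1 -> 0 <= b ->
  (b%:E < box_ratio E r)%E -> ((r `^ (- b))%:E < covering_number E r)%E.
Proof.
move=> /andP[r_gt0 r_lt1] b_ge0.
have lnr_gt0 : 0 < - ln r by rewrite oppr_gt0 ln_lt0// r_gt0.
rewrite /box_ratio; have := covering_number_ge0 E r.
case: covering_number => [n _| _ _|//]; last by rewrite ltry.
rewrite !lte_fin ltr_pdivlMr// => b_lt.
have n_gt0 : 0 < n.
  rewrite ltNge; apply/negP => /ln0 lnn0; move: b_lt.
  by rewrite lnn0 ltNge mulr_ge0// ltW.
by rewrite -ltr_ln ?posrE ?powR_gt0// ln_powR mulNr -mulrN.
Qed.

Lemma box_ratio_ge E r b : 0 < r < 1 ->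
  ((r `^ (- b))%:E <= covering_number E r)%E -> (b%:E <= box_ratio E r)%E.
Proof.
move=> /andP[r_gt0 r_lt1]; have lnr_gt0 : 0 < - ln r by rewrite oppr_gt0 ln_lt0// r_gt0.
have rb_gt0 : 0 < r `^ (- b) by rewrite powR_gt0.
rewrite /box_ratio; case: covering_number => [n| |]; rewrite ?leey//.
rewrite !lee_fin ler_pdivlMr// => rb_le; have := rb_le.
by rewrite -ler_ln ?posrE//; [rewrite ln_powR mulNr -mulrN|exact: lt_le_trans rb_le].
Qed.

Lemma box_ratio_set0 r : box_ratio (@set0 V) r = 0%E.
Proof.
have cov0 : covering_number (@set0 V) r = 0%E.
  apply/eqP; rewrite eq_le covering_number_ge0 andbT.
  have no_ball : 'I_0 -> V by case.
  exact: (covering_number_le (c := no_ball)).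
by rewrite /box_ratio cov0 /= ln0// mul0r.
Qed.

Lemma box_ratio_ge0 E r : 0 < r < 1 -> (0 <= box_ratio E r)%E.
Proof.
move=> r01; have [->|/set0P[x Ex]] := eqVneq E set0; first by rewrite box_ratio_set0.
apply: box_ratio_ge => //; rewrite oppr0 powRr0.
apply/le_ereal_inf_tmp => _ [n [c Ec] <-]; rewrite lee_fin ler1n.
by case: n c Ec => // c Ec; have [[]] := Ec _ Ex.
Qed.

Lemma upper_box_dim_gt_frequently E (b : \bar R) (Q : set R) :
  (b < upper_box_dim E)%E -> (\forall r \near 0^'+, Q r) ->
  exists2 r, Q r & (b < box_ratio E r)%E.
Proof.
move=> bE [e /= e_gt0 Qe]; apply: contrapT => small.
move: bE; apply/negP; rewrite -leNgt.
have half_gt0 : 0 < 2^-1 :> R by rewrite invr_gt0.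
pose delta := Num.min e 2^-1.
apply: (@le_trans _ _ (ereal_sup [set box_ratio E r | r in `]0, delta[ ])).
  apply: ereal_inf_lbound; exists delta => //=.
  by rewrite in_itv/= lt_min e_gt0 half_gt0 gt_min invf_lt1 ?ltr1n ?orbT.
apply: ge_ereal_sup => _ [r /= /[!in_itv]/= /andP[r_gt0 r_lt] <-].
rewrite leNgt; apply/negP => br; apply: small; exists r => //.
apply: Qe => //=; rewrite sub0r normrN gtr0_norm// (lt_le_trans r_lt)//.
by rewrite ge_min lexx.
Qed.

Lemma upper_box_dim_ge E (b : \bar R) :
  (forall delta, 0 < delta < 1 -> exists2 r, 0 < r < delta & (b <= box_ratio E r)%E) ->
  (b <= upper_box_dim E)%E.
Proof.
move=> large; apply/le_ereal_inf_tmp => _ [delta /= /[!in_itv]/= delta01 <-].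
have [r r_itv br] := large _ delta01; apply: (le_trans br).
by apply: ereal_sup_ubound; exists r => //=; rewrite in_itv.
Qed.

Lemma upper_box_dim_ge0 E : (0 <= upper_box_dim E)%E.
Proof.
apply: upper_box_dim_ge => delta /andP[delta_gt0 delta_lt1].
have half_lt : delta / 2 < delta by rewrite ltr_pdivrMr// ltr_pMr// ltr1n.
exists (delta / 2); first by rewrite divr_gt0.
by apply: box_ratio_ge0; rewrite divr_gt0//= (lt_trans half_lt).
Qed.

Lemma upper_box_dim_set0 : upper_box_dim (@set0 V) = 0%E.
Proof.
apply/eqP; rewrite eq_le upper_box_dim_ge0 andbT leNgt; apply/negP => dim_gt0.
have [|r _] := @upper_box_dim_gt_frequently _ _ setT dim_gt0; first exact: nearW.
by rewrite box_ratio_set0 ltxx.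
Qed.

End box_dimension.

Section packing_dimension.
Context {R : realType} {V : pseudoMetricType R}.
Implicit Types (A B : set V) (b : \bar R).

Lemma packing_dim_ge0 A : (0 <= packing_dim A)%E.
Proof.
apply/le_ereal_inf_tmp => _ [F [_ ->]]; apply: (le_trans (upper_box_dim_ge0 (F 0))).
by apply: ereal_sup_ubound; exists 0.
Qed.

Lemma packing_dim_le_cover A (F : nat -> set V) b :
  A `<=` \bigcup_i F i -> (forall i, upper_box_dim (F i) <= b)%E ->
  (packing_dim A <= b)%E.
Proof.
move=> AF Fb; apply: (@le_trans _ _ (ereal_sup [set upper_box_dim (F i) | i in setT])).
  by apply: ereal_inf_lbound; exists F.
by apply: ge_ereal_sup => _ [i _ <-].
Qed.

Lemma packing_dim_lt_cover A b : (packing_dim A < b)%E ->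
  exists2 F : nat -> set V, A `<=` \bigcup_i F i &
    forall i, (upper_box_dim (F i) < b)%E.
Proof.
move=> /ereal_inf_lt[_ [F [AF ->]] Fb]; exists F => // i.
by apply: le_lt_trans Fb; apply: ereal_sup_ubound; exists i.
Qed.

Lemma packing_dim_le_upper_box_dim A : (packing_dim A <= upper_box_dim A)%E.
Proof. by apply: (@packing_dim_le_cover _ (fun=> A)) => // x Ax; exists 0. Qed.

Lemma packing_dim_set0 : packing_dim (@set0 V) = 0%E.
Proof.
apply/eqP; rewrite eq_le packing_dim_ge0 andbT -(@upper_box_dim_set0 R V).
exact: packing_dim_le_upper_box_dim.
Qed.

Lemma le_packing_dim A B : A `<=` B -> (packing_dim A <= packing_dim B)%E.
Proof.
move=> AB; apply: le_ereal_inf => _ [F [BF ->]].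
by exists F; split=> //; exact: subset_trans BF.
Qed.

Lemma packing_dim_bigcup_le (I : countType) (D : set I) (A : I -> set V) (b : R) :
  0 <= b -> (forall i, D i -> (packing_dim (A i) <= b%:E)%E) ->
  (packing_dim (\bigcup_(i in D) A i) <= b%:E)%E.
Proof.
move=> b_ge0 Ab; apply/lee_addgt0Pr => e e_gt0; rewrite -EFinD.
have be_ge0 : (0 <= (b + e)%:E)%E by rewrite lee_fin addr_ge0// ltW.
have cover i : exists F : nat -> set V, (D i -> A i `<=` \bigcup_j F j) /\
    forall j, (upper_box_dim (F j) <= (b + e)%:E)%E.
  have [Di|nDi] := pselect (D i); last first.
    by exists (fun=> set0); split=> // _; rewrite upper_box_dim_set0.
  have [|F AF Fb] := @packing_dim_lt_cover (A i) (b + e)%:E.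
    by rewrite (le_lt_trans (Ab i Di))// lte_fin ltrDl.
  by exists F; split=> // j; exact: ltW.
have [F F_cover] := choice cover.
pose all_F n := if unpickle n is Some (i, j) then F i j else set0.
apply: (packing_dim_le_cover (F := all_F)) => [x [i Di Aix]|n].
  have [/(_ Di _ Aix)[j _ Fijx] _] := F_cover i.
  by exists (pickle (i, j)) => //; rewrite /all_F pickleK.
rewrite /all_F; case: unpickle => [[i j]|]; last by rewrite upper_box_dim_set0.
by have [] := F_cover i.
Qed.

End packing_dimension.

Section spaced_points_of_box_ratio.
Context {R : realType}.

Lemma box_ratio_gt_spaced (E : set R) (r b : R) : 0 < r < 1 -> 0 <= b ->
  (b%:E < box_ratio E r)%E ->
  exists (x : nat -> R) (n : nat), [/\ (0 < n)%N, n%:R <= r `^ (- b),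
    r `^ (- b) <= 2 * n%:R, (forall i, (i < n)%N -> E (x i)) & spaced r n x].
Proof.
move=> r01 b_ge0 /(box_ratio_gt r01 b_ge0) cov; have /andP[r_gt0 r_lt1] := r01.
have rb_ge1 : 1 <= r `^ (- b).
  by rewrite powRN invf_ge1 ?powR_gt0// powR_le1// r_gt0 ltW.
pose n := Num.truncn (r `^ (- b)).
have n_le : n%:R <= r `^ (- b) by rewrite truncn_le// (le_trans _ rb_ge1).
have n_gt0 : (0 < n)%N by rewrite truncn_gt0.
have [|s [sz uniq_s sE sep]] := @covering_number_gt_separated _ _ E r n.-1 r_gt0.
  by apply: le_lt_trans cov; rewrite lee_fin (le_trans _ n_le)// ler_nat leq_pred.
rewrite prednK// in sz.
exists (nth 0 (sort <=%R s)), n; split=> //.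
- rewrite (le_trans (ltW (truncnS_gt _)))// -natrM ler_nat mul2n -addnn.
  by rewrite -[X in (X <= _)%N]addn1 leq_add2l.
- by move=> i ni; apply: sE; rewrite -(mem_sort <=%R) mem_nth// size_sort sz.
- rewrite -sz -(size_sort <=%R); apply: sorted_spaced.
  + exact: sort_sorted le_total _.
  + by rewrite sort_uniq.
  + move=> x y; rewrite !mem_sort => xs ys xy; rewrite leNgt; apply/negP.
    exact: sep.
Qed.

End spaced_points_of_box_ratio.

Section energy_of_spaced_points.
Context {R : realType}.

(* The two cases bound the number of points by the size of the sample, and by
   the number of spacings in a window of size [r^theta]. *)
Definition energy_exponent (d : nat) (a b theta : R) : Prop :=
  a + b * (1 - a) <= theta * d%:R \/ 1 <= theta * (d%:R + 1 - a).

Lemma powR_energy_le (r a b theta : R) d m :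
  0 < r < 1 -> 0 < a < 1 -> energy_exponent d a b theta ->
  m%:R <= r `^ (- b) -> m%:R <= 4 * r `^ theta / r ->
  (r `^ theta) ^+ d * (r `^ (- a) * m%:R `^ (1 - a)) <= 4.
Proof.
move=> /andP[r_gt0 r_lt1] /andP[a_gt0 a_lt1] exponent m_le_size m_le_window.
have r_neq0 : r != 0 by rewrite gt_eqF.
have powD x y : r `^ x * r `^ y = r `^ (x + y) by rewrite powRD// r_neq0 implybT.
have le1 x : 0 <= x -> r `^ x <= 1 by apply: powR_le1; rewrite r_gt0 ltW.
have mono y : 0 <= y -> m%:R <= y -> m%:R `^ (1 - a) <= y `^ (1 - a).
  by move=> y_ge0 my; apply: ge0_ler_powR; rewrite ?nnegrE// subr_ge0 ltW.
rewrite -powR_mulrn ?powR_ge0// -powRrM mulrA powD.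
case: exponent => exponent.
  apply: (@le_trans _ _ (r `^ (theta * d%:R - a) * r `^ (- b * (1 - a)))).
    by rewrite ler_wpM2l ?powR_ge0// powRrM mono ?powR_ge0.
  by rewrite powD (le_trans (le1 _ _)) ?ler1n//; lra.
apply: (@le_trans _ _ (r `^ (theta * d%:R - a) * (4 * r `^ ((theta - 1) * (1 - a))))).
  rewrite ler_wpM2l ?powR_ge0//.
  have windowE : 4 * r `^ theta / r = 4 * r `^ (theta - 1).
    by rewrite powRB ?r_neq0 ?implybT// powRr1 ?mulrA// ltW.
  rewrite windowE in m_le_window.
  rewrite (le_trans (mono _ _ m_le_window)) ?mulr_ge0 ?powR_ge0//.
  rewrite powRM ?powR_ge0// -powRrM ler_wpM2r ?powR_ge0//.
  by rewrite ler1_powR ?ler1n// gerBl ltW.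
by rewrite mulrCA powD ger_pMr// le1//; lra.
Qed.

Lemma spaced_energy_le (x : nat -> R) (r a b theta : R) d n (i : 'I_n) :
  0 < r < 1 -> 0 < a < 1 -> spaced r n x -> n%:R <= r `^ (- b) ->
  energy_exponent d a b theta ->
  \sum_(j < n | (`|x i - x j| <= 4 * r `^ theta) && (j != i))
     (r `^ theta) ^+ d * `|x i - x j| `^ (- a) <= 8 / (1 - a).
Proof.
move=> r01 a01 xr n_le exponent; have /andP[r_gt0 r_lt1] := r01.
have q_gt0 : 0 < 1 - a by case/andP: a01 => _; rewrite subr_gt0.
have window_ge0 : 0 <= 4 * r `^ theta / r by rewrite divr_ge0 ?mulr_ge0 ?powR_ge0 ?ltW.
pose m := minn n (Num.truncn (4 * r `^ theta / r)).
have near_le_m (j : 'I_n) : `|x i - x j| <= 4 * r `^ theta -> (`|i - j| <= m)%N.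
  move=> xij; rewrite leq_min; apply/andP; split.
    case: (leqP i j) => [ij|/ltnW ij].
      by rewrite distnEr// (leq_trans (leq_subr _ _))// ltnW.
    by rewrite distnEl// (leq_trans (leq_subr _ _))// ltnW.
  rewrite truncn_ge_nat// ler_pdivlMr// mulrC; apply: le_trans xij.
  by apply: (spaced_dist_ge xr).
have m_energy : (r `^ theta) ^+ d * (r `^ (- a) * m%:R `^ (1 - a)) <= 4.
  apply: powR_energy_le exponent _ _ => //.
    by apply: le_trans n_le; rewrite ler_nat geq_minl.
  by rewrite -truncn_ge_nat// geq_minr.
rewrite -mulr_sumr (le_trans (ler_wpM2l _ (sum_spaced_le r_gt0 a01 xr near_le_m)))//.
  by rewrite exprn_ge0// powR_ge0.
move: m_energy; set u := _ ^+ d; set v := _ `^ (- a); set w := m%:R `^ (1 - a) => uvw.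
have -> : u * (2 * (v * (w / (1 - a)))) = 2 * (u * (v * w)) / (1 - a) by ring.
by rewrite ler_pM2r ?invr_gt0//; lra.
Qed.

End energy_of_spaced_points.

Section pair_energy.
Context {R : realType} {d : nat}.
Implicit Types (f : R -> 'rV[R]_d) (x : nat -> R) (rho : R).

(* Points of a graph that lie near a common ball of radius [rho] have abscissas
   within [4 * rho]; leaving out all other pairs is what the second case of
   [energy_exponent] rests on. *)
Definition pair_energy f x (n : nat) rho : R :=
  \sum_(ij : 'I_n * 'I_n | `|x ij.1 - x ij.2| <= 4 * rho)
    increment_kernel f rho (x ij.1) (x ij.2).

Lemma pair_energy_ge0 f x n rho : 0 <= pair_energy f x n rho.
Proof. by apply: sumr_ge0 => ij _; exact: increment_kernel_ge0. Qed.

Lemma cover_near_pairs f x n rho (G : set (R * 'rV[R]_d)) m (c : 'I_m -> R * 'rV[R]_d) :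
  0 < rho -> (forall i, (i < n)%N -> closure G (x i, f (x i))) ->
  G `<=` \bigcup_(k in setT) ball (c k) rho ->
  exists k : 'I_n -> 'I_m, forall i j, k i = k j ->
    `|x i - x j| <= 4 * rho /\ forall l, `|f (x i) ord0 l - f (x j) ord0 l| <= 4 * rho.
Proof.
move=> rho_gt0 xG Gc.
have ex_ball (i : 'I_n) : exists k, ball (c k) (rho + rho) (x i, f (x i)).
  have [q [Gq q_near]] := xG i (ltn_ord i) _ (nbhsx_ballx _ _ rho_gt0).
  have [k _ ck] := Gc _ Gq; exists k.
  by apply: (ball_triangle ck); exact: ball_sym.
have [k k_ball] := choice ex_ball; exists k => i j kij.
have [/= xij [_ fij]] : ball (x i, f (x i)) (rho + rho + (rho + rho)) (x j, f (x j)).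
  apply: (@ball_triangle _ _ (c (k i))); first exact/ball_sym/k_ball.
  by rewrite kij; exact: k_ball.
have -> : 4 * rho = rho + rho + (rho + rho) by ring.
by split=> [|l]; apply: ltW; [exact: xij|exact: fij ord0 l].
Qed.

Lemma pair_energy_ge f x n rho (G : set (R * 'rV[R]_d)) m (c : 'I_m -> R * 'rV[R]_d) :
  0 < rho -> (forall i, (i < n)%N -> closure G (x i, f (x i))) ->
  G `<=` \bigcup_(k in setT) ball (c k) rho ->
  gauss_fun 4 ^+ d * n%:R ^+ 2 <= m%:R * pair_energy f x n rho.
Proof.
move=> rho_gt0 xG Gc; have [k k_near] := cover_near_pairs rho_gt0 xG Gc.
rewrite mulrC (le_trans (ler_wpM2r _ (sqr_card_le_fibre_pairs k)))//.
  by rewrite exprn_ge0// gauss_fun_ge0.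
rewrite -mulrA ler_wpM2l// pair_big/= mulr_suml /pair_energy [leRHS]big_mkcond/=.
apply: ler_sum => -[i j] _ /=; have [/k_near[x_near f_near]|_] := eqVneq (k i) (k j).
  by rewrite x_near mul1r increment_kernel_ge.
by rewrite mul0r; case: ifP => // _; exact: increment_kernel_ge0.
Qed.

Lemma covering_number_graph_ge f (E : set R) x n (r b eps rho : R)
    (G : set (R * 'rV[R]_d)) :
  0 < r -> 0 < rho -> (0 < n)%N -> r `^ (- b) <= 2 * n%:R ->
  (forall i, (i < n)%N -> E (x i)) -> (fun t => (t, f t)) @` E `<=` closure G ->
  pair_energy f x n rho <= gauss_fun 4 ^+ d * n%:R * r `^ (- eps) / 2 ->
  ((r `^ (- (b - eps)))%:E <= covering_number G rho)%E.
Proof.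
move=> r_gt0 rho_gt0 n_gt0 rb_le xE EG energy_le.
apply/le_ereal_inf_tmp => _ [m [c Gc] <-]; rewrite lee_fin.
have -> : r `^ (- (b - eps)) = r `^ (- b) / r `^ (- eps).
  by rewrite -powRB ?(gt_eqF r_gt0) ?implybT// opprB opprK addrC.
rewrite ler_pdivrMr ?powR_gt0// (le_trans rb_le)//.
have xG i : (i < n)%N -> closure G (x i, f (x i)).
  by move=> ni; apply: EG; exists (x i) => //; exact: xE.
have lower := le_trans (pair_energy_ge rho_gt0 xG Gc) (ler_wpM2l (ler0n _ m) energy_le).
have en_gt0 : 0 < gauss_fun 4 ^+ d * n%:R :> R.
  by rewrite mulr_gt0 ?exprn_gt0 ?expR_gt0// ltr0n.
rewrite -(ler_pM2l en_gt0).
by move: lower; move: (r `^ (- eps)) => q; lra.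
Qed.

End pair_energy.

Section almost_everywhere.
Context d (T : measurableType d) (R : realType) (mu : {measure set T -> \bar R}).

Lemma ae_infinitely_often_notin (B : nat -> set T) :
  (forall k, measurable (B k)) -> mu (B k) @[k --> \oo] --> 0%E ->
  {ae mu, forall w m, exists2 k, (m <= k)%N & ~ B k w}.
Proof.
move=> mB muB0; apply: ae_foralln => m.
pose N := \bigcap_(k in [set k | (m <= k)%N]) B k.
have mN : measurable N by apply: bigcap_measurable => //; exists m => /=.
exists N; split=> [//||w /= /forall2NP nB k mk]; last by have [|/contrapT] := nB k.
apply/eqP; rewrite eq_le measure_ge0 andbT.
apply: (cvge_to_ge muB0); exists m => // k mk.
by apply: le_measure; rewrite ?inE// => w; apply.
Qed.

Lemma ae_forall_count (I : countType) (Q : I -> T -> Prop) :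
  (forall i, {ae mu, forall w, Q i w}) -> {ae mu, forall w i, Q i w}.
Proof.
move=> aeQ; have : {ae mu, forall w n i, unpickle n = Some i -> Q i w}.
  apply: ae_foralln => n; case: unpickle => [i|]; last exact: aeW.
  by apply: filterS (aeQ i) => w Qw _ [<-].
by apply: filterS => w Qw i; exact: Qw (pickleK i).
Qed.

Lemma ae_ge_of_lt (f : T -> \bar R) (M : R) :
  (forall b, b < M -> {ae mu, forall w, (b%:E <= f w)%E}) ->
  {ae mu, forall w, (M%:E <= f w)%E}.
Proof.
move=> ae_ge.
have : {ae mu, forall w n, ((M - harmonic n)%:E <= f w)%E}.
  by apply: ae_foralln => n; apply: ae_ge; rewrite gtrBl harmonic_gt0.
apply: filterS => w f_ge; apply/lee_subgt0Pr => e e_gt0.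
have [n _ /(_ _ (leqnn n)) small] := cvgr_lt 0 (@cvg_harmonic R) _ e_gt0.
by rewrite (le_trans _ (f_ge n))// -EFinB lee_fin lerD2l lerN2 ltW.
Qed.

End almost_everywhere.

Section fbm_graph_box_dimension.
Context {R : realType} dT (T : measurableType dT) (P : probability T R).
Variables (d : nat) (alpha : R) (X : R -> T -> 'rV[R]_d).
Hypotheses (d_gt0 : (0 < d)%N) (alpha_gt0 : 0 < alpha) (alpha_d_lt1 : alpha * d%:R < 1).
Hypothesis fbmX : is_fbm P alpha X.

Let alpha_d01 : 0 < alpha * d%:R < 1. Proof. by rewrite mulr_gt0 ?ltr0n. Qed.

Lemma measurable_pair_energy (x : nat -> R) n rho :
  measurable_fun setT (fun w => pair_energy (X ^~ w) x n rho).
Proof.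
under eq_fun do rewrite /pair_energy -big_filter.
by apply: measurable_sum => ij; exact: measurable_increment_kernel fbmX _ _ _.
Qed.

Lemma integral_pair_energy (x : nat -> R) n rho :
  (\int[P]_w (pair_energy (X ^~ w) x n rho)%:E =
   (\sum_(ij : 'I_n * 'I_n | `|x ij.1 - x ij.2| <= 4 * rho)
      \int[P]_w increment_kernel (X ^~ w) rho (x ij.1) (x ij.2))%:E)%E.
Proof.
under eq_integral do rewrite /pair_energy -big_filter -sumEFin.
rewrite ge0_integral_sum//=; last 2 first.
- by move=> ij; apply/measurable_EFinP; exact: measurable_increment_kernel fbmX _ _ _.
- by move=> ij w _; rewrite lee_fin increment_kernel_ge0.
rewrite big_filter -sumEFin; apply: eq_bigr => ij _.
exact: integral_increment_kernel fbmX _ _ _.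
Qed.

Lemma expected_pair_energy_le (x : nat -> R) (r b theta : R) n :
  0 < r < 1 -> spaced r n x -> n%:R <= r `^ (- b) ->
  energy_exponent d (alpha * d%:R) b theta ->
  (\int[P]_w (pair_energy (X ^~ w) x n (r `^ theta))%:E <=
   (n%:R * (1 + 8 / (1 - alpha * d%:R)))%:E)%E.
Proof.
move=> r01 xr n_le exponent; have /andP[r_gt0 r_lt1] := r01.
have rho_gt0 : 0 < r `^ theta by rewrite powR_gt0.
rewrite integral_pair_energy lee_fin; rewrite -(pair_big_dep xpredT
  (fun i j : 'I_n => `|x i - x j| <= 4 * r `^ theta)
  (fun i j : 'I_n => \int[P]_w increment_kernel (X ^~ w) (r `^ theta) (x i) (x j)))/=.
have -> K : n%:R * K = \sum_(i < n) K by rewrite sumr_const card_ord mulr_natl.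
apply: ler_sum => i _.
rewrite (bigD1 i)/=; last by rewrite subrr normr0 mulr_ge0// ltW.
apply: lerD.
  under eq_Rintegral do rewrite increment_kernel_diag.
  by rewrite Rintegral_cst// [X in fine X](@probability_setT _ _ _ P) mulr1.
apply: le_trans (spaced_energy_le i r01 alpha_d01 xr n_le exponent).
apply: ler_sum => j /andP[_ ji].
apply: (Rintegral_increment_kernel_le alpha_gt0 fbmX) => //.
by rewrite (spaced_neq r_gt0 xr)// eq_sym.
Qed.

Lemma pair_energy_tail_le (x : nat -> R) (r b theta level : R) n :
  0 < r < 1 -> spaced r n x -> n%:R <= r `^ (- b) ->
  energy_exponent d (alpha * d%:R) b theta -> 0 < level ->
  (P [set w | (level <= pair_energy (X ^~ w) x n (r `^ theta))%R] <=
   (n%:R * (1 + 8 / (1 - alpha * d%:R)) / level)%:E)%E.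
Proof.
move=> r01 xr n_le exponent level_gt0.
have m_energy : measurable_fun setT
    (fun w => (pair_energy (X ^~ w) x n (r `^ theta))%:E).
  by apply/measurable_EFinP; exact: measurable_pair_energy.
have := le_integral_abse P measurableT m_energy level_gt0; rewrite setTI.
under eq_integral do rewrite gee0_abs ?lee_fin ?pair_energy_ge0//.
under eq_set do rewrite /= ger0_norm ?pair_energy_ge0// lee_fin.
move=> /le_trans /(_ (expected_pair_energy_le r01 xr n_le exponent)).
by rewrite -lee_pdivlMl// -EFinM mulrC.
Qed.

Definition energy_tail_constant : R :=
  2 * (1 + 8 / (1 - alpha * d%:R)) / gauss_fun 4 ^+ d.

Lemma energy_tail_constant_gt0 : 0 < energy_tail_constant.
Proof.
rewrite divr_gt0 ?exprn_gt0 ?expR_gt0// mulr_gt0// ltr_pwDl//.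
by rewrite divr_ge0// subr_ge0 ltW.
Qed.

Lemma box_ratio_graph_event (E : set R) (r g b theta : R) :
  0 < r < 1 -> 0 <= g -> 0 < theta -> energy_exponent d (alpha * d%:R) g theta ->
  (g%:E < box_ratio E r)%E ->
  exists B : set T, [/\ measurable B,
    (P B <= (energy_tail_constant * r `^ (g - b * theta))%:E)%E &
    forall w, ~ B w -> forall G : set (R * 'rV[R]_d),
      graph_on X w E `<=` closure G -> (b%:E <= box_ratio G (r `^ theta))%E].
Proof.
move=> r01 g_ge0 theta_gt0 exponent gE; have /andP[r_gt0 r_lt1] := r01.
have [x [n [n_gt0 n_le n_ge xE xr]]] := box_ratio_gt_spaced r01 g_ge0 gE.
have rho01 : 0 < r `^ theta < 1.
  by rewrite powR_gt0//= powR_lt1.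
have /andP[rho_gt0 _] := rho01.
pose level := gauss_fun 4 ^+ d * n%:R * r `^ (- (g - b * theta)) / 2.
have level_gt0 : 0 < level.
  by rewrite divr_gt0// !mulr_gt0 ?powR_gt0 ?exprn_gt0 ?expR_gt0 ?ltr0n.
exists [set w | level <= pair_energy (X ^~ w) x n (r `^ theta)]; split.
- rewrite -[X in measurable X]setTI.
  have := measurable_pair_energy x n (r `^ theta) measurableT
    (measurable_itv `[level, +oo[).
  by under eq_set do rewrite /= in_itv/= andbT.
- rewrite (le_trans (pair_energy_tail_le r01 xr n_le exponent level_gt0))// lee_fin.
  have : r `^ (g - b * theta) != 0 by rewrite gt_eqF ?powR_gt0.
  have : gauss_fun 4 ^+ d != 0 :> R by rewrite gt_eqF ?exprn_gt0 ?expR_gt0.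
  have : n%:R != 0 :> R by rewrite pnatr_eq0 -lt0n.
  rewrite /level powRN /energy_tail_constant.
  move: (_ ^+ d) (_ `^ _) n%:R (8 / _) => e q k c k_neq0 e_neq0 q_neq0.
  rewrite [leLHS](_ : _ = 2 * (1 + c) / e * q)//.
  by field; rewrite k_neq0 e_neq0 q_neq0.
- move=> w B'w G EG; apply: box_ratio_ge => //; rewrite -powRrM.
  have -> : theta * - b = - (g - (g - b * theta)) by ring.
  apply: (covering_number_graph_ge (f := X ^~ w) (x := x) (n := n)) EG _ => //.
  by rewrite leNgt; apply/negP => lt_energy; apply: B'w; exact: ltW.
Qed.

Lemma small_box_ratio_graph_event (E : set R) (g b theta e : R) :
  0 <= g -> 0 < theta -> b * theta < g -> energy_exponent d (alpha * d%:R) g theta ->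
  (g%:E < upper_box_dim E)%E -> 0 < e ->
  exists (rho : R) (B : set T), [/\ 0 < rho < e, measurable B, (P B <= e%:E)%E &
    forall w, ~ B w -> forall G : set (R * 'rV[R]_d),
      graph_on X w E `<=` closure G -> (b%:E <= box_ratio G rho)%E].
Proof.
move=> g_ge0 theta_gt0 b_lt exponent gE e_gt0.
have gap_gt0 : 0 < g - b * theta by rewrite subr_gt0.
have [r [r01 r_theta r_gap] gr] : exists2 r, [/\ 0 < r < 1, r `^ theta < e &
    r `^ (g - b * theta) < e / energy_tail_constant] & (g%:E < box_ratio E r)%E.
  apply: (upper_box_dim_gt_frequently gE); near=> r; split.
  - by apply/andP; split; near: r; [exact: nbhs_right_gt|exact: nbhs_right_lt].
  - by near: r; exact: cvgr_lt (powR_cvg0 theta_gt0) _ e_gt0.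
  - near: r; apply: cvgr_lt (powR_cvg0 gap_gt0) _ _.
    by rewrite divr_gt0// energy_tail_constant_gt0.
have [B [mB PB B_box]] := box_ratio_graph_event b r01 g_ge0 theta_gt0 exponent gr.
exists (r `^ theta), B; split=> //; first by rewrite powR_gt0//; case/andP: r01.
by rewrite (le_trans PB)// lee_fin mulrC -ler_pdivlMr ?energy_tail_constant_gt0// ltW.
Unshelve. all: end_near. Qed.

Lemma ae_upper_box_dim_graph_ge (E : set R) (g b theta : R) :
  0 <= g -> 0 < theta -> b * theta < g -> energy_exponent d (alpha * d%:R) g theta ->
  (g%:E < upper_box_dim E)%E ->
  {ae P, forall w, forall G : set (R * 'rV[R]_d),
    graph_on X w E `<=` closure G -> (b%:E <= upper_box_dim G)%E}.
Proof.
move=> g_ge0 theta_gt0 b_lt exponent gE.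
have /choice[rho /choice[B rhoB]] k := small_box_ratio_graph_event
  g_ge0 theta_gt0 b_lt exponent gE (harmonic_gt0 k).
have PB0 : P (B k) @[k --> \oo] --> 0%E.
  apply: (squeeze_cvge _ (cvg_cst 0%E) cvge_harmonic); apply: nearW => k.
  by have [_ _ PB _] := rhoB k; rewrite measure_ge0.
apply: filterS (ae_infinitely_often_notin _ PB0) => [w often G EG|k]; last first.
  by have [] := rhoB k.
apply: upper_box_dim_ge => delta /andP[delta_gt0 _].
have [m _ harmonic_lt] := cvgr_lt 0 (@cvg_harmonic R) _ delta_gt0.
have [k mk B'kw] := often m; have [/andP[rho_gt0 rho_lt] _ _ B_box] := rhoB k.
exists (rho k); last exact: B_box B'kw _ EG.
by rewrite rho_gt0 (lt_trans rho_lt)//; exact: harmonic_lt.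
Qed.

End fbm_graph_box_dimension.

Section baire_space.

Definition agree (n : nat) (x y : nat -> nat) := forall k, (k < n)%N -> x k = y k.

Definition baire_closure (B : set (nat -> nat)) : set (nat -> nat) :=
  [set x | forall n, exists2 y, B y & agree n y x].

Definition cylinder (s : seq nat) : set (nat -> nat) :=
  [set x | agree (size s) x (nth 0 s)].

Lemma agree_leq n m x y : (n <= m)%N -> agree m x y -> agree n x y.
Proof. by move=> nm xy k kn; apply: xy; exact: leq_trans nm. Qed.

Lemma agree_trans n x y z : agree n x y -> agree n y z -> agree n x z.
Proof. by move=> xy yz k kn; rewrite xy// yz. Qed.

Lemma cylinder_mkseq x n : cylinder (mkseq x n) = [set y | agree n y x].
Proof.
apply/seteqP; split=> y; rewrite /cylinder /agree /= size_mkseq => yx k kn.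
  by rewrite yx ?nth_mkseq.
by rewrite nth_mkseq ?yx.
Qed.

Lemma nested_agree_limit (x : nat -> nat -> nat) (n : nat -> nat) :
  (forall i, n i < n i.+1)%N -> (forall i, agree (n i) (x i.+1) (x i)) ->
  exists z, forall i, agree (n i) z (x i).
Proof.
move=> n_lt x_agree.
have n_ge i : (i <= n i)%N by elim: i => // i IH; exact: leq_ltn_trans (n_lt i).
have chain i j : agree (n i) (x (i + j)%N) (x i).
  elim: j => [|j IH]; first by rewrite addn0.
  apply: agree_trans IH; rewrite addnS; apply: agree_leq (x_agree _).
  elim: j => [|j IH]; first by rewrite addn0.
  by rewrite addnS (leq_trans IH)// ltnW.
exists (fun k => x k.+1 k) => i k ki.
have [ik|/ltnW ki'] := leqP i k.+1; first by rewrite -(subnKC ik) chain.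
by rewrite -(subnKC ki') chain// (leq_trans _ (n_ge _)).
Qed.

Lemma baire_category (C : set (nat -> nat)) (B : nat -> set (nat -> nat)) :
  baire_closure C `<=` C -> C !=set0 -> C `<=` \bigcup_i B i ->
  exists i x n, C x /\ C `&` [set y | agree n y x] `<=` baire_closure (C `&` B i).
Proof.
move=> closedC [x0 Cx0] CB; apply: contrapT => nowhere_dense.
have avoid (ip : nat * ((nat -> nat) * nat)) : exists q : (nat -> nat) * nat,
    let: (i, p) := ip in C p.1 -> [/\ C q.1, (p.2 < q.2)%N, agree p.2 q.1 p.1 &
      forall y, C y -> agree q.2 y q.1 -> ~ B i y].
  case: ip => i [x n]; have [Cx|nCx] := pselect (C x); last by exists (x, n) => /nCx.
  apply: contrapT => stuck; apply: nowhere_dense.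
  exists i, x, n; split=> // y [Cy yx] m.
  apply: contrapT => far; apply: stuck; exists (y, maxn m n.+1) => _; split=> //=.
    exact: leq_maxr.
  move=> z Cz zy Bz; apply: far; exists z => //.
  by apply: agree_leq zy; exact: leq_maxl.
have [next next_avoids] := choice avoid.
pose p := fix p i := if i is j.+1 then next (j, p j) else (x0, 0%N).
have Cp i : C (p i).1 by elim: i => // i IH /=; have [] := next_avoids (i, p i) IH.
have p_avoids i := next_avoids (i, p i) (Cp i).
have [||z zp] := @nested_agree_limit (fun i => (p i).1) (fun i => (p i).2).
- by move=> i; have [] := p_avoids i.
- by move=> i; have [] := p_avoids i.
have p2_ge i : (i <= (p i).2)%N.
  by elim: i => // i IH; apply: leq_ltn_trans IH _; have [] := p_avoids i.
have Cz : C z.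
  apply: closedC => n; exists (p n).1 => // k kn.
  by rewrite (zp n)// (leq_trans kn).
have [i _ Biz] := CB _ Cz.
by have [_ _ _ /(_ z Cz)] := p_avoids i; apply=> //; exact: zp i.+1.
Qed.

Definition prefix_continuous {V : topologicalType} (h : (nat -> nat) -> V) :=
  forall x U, nbhs (h x) U -> exists n, forall y, agree n y x -> U (h y).

Lemma baire_continuous_comp {R : realType} {V : topologicalType}
    (f : (nat -> nat) -> R) (h : R -> V) :
  baire_continuous f -> continuous h -> prefix_continuous (h \o f).
Proof.
move=> fc hc x U /hc /nbhs_ballP[e /= e_gt0 eU].
have [n fn] := fc x _ e_gt0; exists n => y yx.
by apply: eU; rewrite /ball/= distrC; exact: fn.
Qed.

Lemma prefix_continuous_closure {V : topologicalType} (h : (nat -> nat) -> V)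
    (B : set (nat -> nat)) :
  prefix_continuous h -> h @` baire_closure B `<=` closure (h @` B).
Proof.
move=> hc _ [x Bx <-] U /hc[n hU]; have [y By yx] := Bx n.
by exists (h y); split; [exists y|exact: hU].
Qed.

End baire_space.

Section packing_dimension_of_images.
Context {R : realType} {V : pseudoMetricType R}.

Lemma packing_dim_image_ge (h : (nat -> nat) -> V) (C : set (nat -> nat)) (b : \bar R) :
  prefix_continuous h -> baire_closure C `<=` C -> C !=set0 ->
  (forall s, cylinder s `&` C !=set0 -> forall G,
     h @` (cylinder s `&` C) `<=` closure G -> (b <= upper_box_dim G)%E) ->
  (b <= packing_dim (h @` C))%E.
Proof.
move=> hc closedC C_neq0 dimC; apply/le_ereal_inf_tmp => _ [F [CF ->]].
have [|i [x [n [Cx dense_i]]]] :=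
    @baire_category C (fun i => h @^-1` F i) closedC C_neq0.
  by move=> y Cy; have [i _ Fi] := CF (h y) (imageP _ Cy); exists i.
apply: (@le_trans _ _ (upper_box_dim (F i))); last by apply: ereal_sup_ubound; exists i.
apply: (dimC (mkseq x n)); rewrite cylinder_mkseq setIC; first by exists x.
apply: subset_trans (image_subset h dense_i) _.
apply: subset_trans (prefix_continuous_closure hc) _.
by apply: closure_subset => _ [y [_ Fy] <-].
Qed.

End packing_dimension_of_images.

Section packing_kernel.
Context {R : realType} (f : (nat -> nat) -> R) (g : R).

(* Closed, and each nonempty relatively open piece still has an image of packing
   dimension above [g]: this replaces the choice of a compact subset of the
   analytic set. *)
Definition packing_kernel : set (nat -> nat) :=
  [set x | forall s, cylinder s x -> (g%:E < packing_dim (f @` cylinder s))%E].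

Lemma packing_kernel_closed : baire_closure packing_kernel `<=` packing_kernel.
Proof.
move=> x x_lim s sx; have [y Ky yx] := x_lim (size s).
by apply: Ky; exact: agree_trans sx.
Qed.

(* The discarded cylinders are countably many, and countable stability applies
   to the union of their images. *)
Lemma packing_dim_cylinder_kernel s : (g%:E < packing_dim (f @` cylinder s))%E ->
  (g%:E < packing_dim (f @` (cylinder s `&` packing_kernel)))%E.
Proof.
apply: contraTT; rewrite -!leNgt => small_kernel.
have g_ge0 : 0 <= g by rewrite -lee_fin (le_trans (packing_dim_ge0 _) small_kernel).
pose D := [set o : option (seq nat) |
  if o is Some t then (packing_dim (f @` cylinder t) <= g%:E)%E else true].
pose A (o : option (seq nat)) :=
  if o is Some t then f @` cylinder t else f @` (cylinder s `&` packing_kernel).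
apply: (@le_trans _ _ (packing_dim (\bigcup_(o in D) A o))); last first.
  by apply: packing_dim_bigcup_le => // -[t|].
apply: le_packing_dim => _ [x sx <-]; have [Kx|] := pselect (packing_kernel x).
  by exists None => //; exists x.
move=> /existsNP[t /not_implyP[tx /negP]]; rewrite -leNgt => small_t.
by exists (Some t) => //; exists x.
Qed.

Lemma packing_kernel_neq0 : (g%:E < packing_dim (range f))%E -> packing_kernel !=set0.
Proof.
move=> gf; apply/set0P/eqP => K0.
have nil_cylinder : cylinder [::] = setT by apply/seteqP; split.
have := @packing_dim_cylinder_kernel [::]; rewrite nil_cylinder K0 setI0 image_set0.
move=> /(_ gf); rewrite packing_dim_set0 lte_fin => g_lt0.
have : packing_kernel (fun=> 0).
  by move=> s _; rewrite (lt_le_trans _ (packing_dim_ge0 _))// lte_fin.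
by rewrite K0.
Qed.

End packing_kernel.

Section fbm_graph_packing_dimension.
Context {R : realType} dT (T : measurableType dT) (P : probability T R).
Variables (d : nat) (alpha : R) (X : R -> T -> 'rV[R]_d).
Hypotheses (d_gt0 : (0 < d)%N) (alpha_gt0 : 0 < alpha) (alpha_d_lt1 : alpha * d%:R < 1).
Hypothesis fbmX : is_fbm P alpha X.

Lemma ae_packing_dim_graph_ge (A : set R) (g b theta : R) :
  0 <= g -> 0 < theta -> b * theta < g -> energy_exponent d (alpha * d%:R) g theta ->
  analytic_set A -> (g%:E < packing_dim A)%E ->
  {ae P, forall w, (b%:E <= packing_dim (graph_on X w A))%E}.
Proof.
move=> g_ge0 theta_gt0 b_lt exponent [->|[f [fc <-]]] gA.
  by move: gA; rewrite packing_dim_set0 lte_fin ltNge g_ge0.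
pose K := packing_kernel f g.
have ae_cylinder : {ae P, forall w s, cylinder s `&` K !=set0 ->
    forall G : set (R * 'rV[R]_d),
      graph_on X w (f @` (cylinder s `&` K)) `<=` closure G ->
      (b%:E <= upper_box_dim G)%E}.
  apply: ae_forall_count => s.
  have [[x [sx Kx]]|empty] := pselect (cylinder s `&` K !=set0); last exact: aeW.
  have g_lt := lt_le_trans (packing_dim_cylinder_kernel (Kx _ sx))
    (packing_dim_le_upper_box_dim _).
  apply: filterS (ae_upper_box_dim_graph_ge d_gt0 alpha_gt0 alpha_d_lt1 fbmX
    g_ge0 theta_gt0 b_lt exponent g_lt) => w box_ge _.
  exact: box_ge.
apply: filterS2 ae_cylinder fbmX.2.2 => w box_ge Xc.
have graph_cts : prefix_continuous ((fun t => (t, X t w)) \o f).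
  by apply: (baire_continuous_comp fc) => t; exact: cvg_pair cvg_id (Xc t).
have K_ge : (b%:E <= packing_dim (((fun t => (t, X t w)) \o f) @` K))%E.
  apply: packing_dim_image_ge graph_cts (@packing_kernel_closed _ _ _) _ _.
    exact: packing_kernel_neq0.
  by move=> s sK G; rewrite -image_comp; exact: box_ge.
apply: le_trans K_ge _; apply: le_packing_dim => _ [x _ <-].
by exists (f x) => //; exists x.
Qed.

Lemma ae_packing_dim_graph_ge_div (A : set R) (beta theta : R) :
  0 < theta ->
  (forall g, 0 <= g < beta -> energy_exponent d (alpha * d%:R) g theta) ->
  analytic_set A -> packing_dim A = beta%:E ->
  {ae P, forall w, ((beta / theta)%:E <= packing_dim (graph_on X w A))%E}.
Proof.
move=> theta_gt0 exponent anA dimA; apply: ae_ge_of_lt => b b_lt.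
have [b_ge0|b_lt0] := leP 0 b; last first.
  by apply: aeW => w; rewrite (le_trans _ (packing_dim_ge0 _))// lee_fin ltW.
rewrite ltr_pdivlMr// in b_lt.
pose g := (b * theta + beta) / 2.
have g_gt : b * theta < g by rewrite /g; lra.
have g_lt : g < beta by rewrite /g; lra.
have g_ge0 : 0 <= g by rewrite (le_trans _ (ltW g_gt))// mulr_ge0// ltW.
apply: (ae_packing_dim_graph_ge g_ge0 theta_gt0 g_gt) => //.
  by apply: exponent; rewrite g_ge0.
by rewrite dimA lte_fin.
Qed.

End fbm_graph_packing_dimension.

Unset Implicit Arguments.

Theorem theorem1p15 (R : realType) (dT : measure_display) (T : measurableType dT)
  (P : probability T R) (d : nat) (alpha beta : R)
  (X : R -> T -> 'rV[R]_d) (A : set R) :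
  (0 < d)%N -> 0 < alpha -> alpha < 1 -> alpha * d%:R < 1 ->
  is_fbm P alpha X ->
  analytic_set A -> packing_dim A = beta%:E ->
  {ae P, forall w,
    (Num.max (beta * d%:R / (alpha * d%:R + beta * (1 - alpha * d%:R)))
             (beta * (d%:R + 1 - alpha * d%:R)))%:E
    <= packing_dim (graph_on X w A)}%E.
Proof.
move=> d_gt0 alpha_gt0 _ alpha_d_lt1 fbmX anA dimA.
have beta_ge0 : 0 <= beta by rewrite -lee_fin -dimA packing_dim_ge0.
have dR_gt0 : 0 < d%:R :> R by rewrite ltr0n.
have alpha_d_gt0 : 0 < alpha * d%:R by rewrite mulr_gt0.
have subr_alpha_d_gt0 : 0 < 1 - alpha * d%:R by rewrite subr_gt0.
have bound := ae_packing_dim_graph_ge_div d_gt0 alpha_gt0 alpha_d_lt1 fbmX _ _ anA dimA.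
rewrite maxEle; case: ifP => _.
- have window_gt0 : 0 < d%:R + 1 - alpha * d%:R by rewrite -addrA addr_gt0.
  rewrite -[X in beta * X]invrK; apply: bound => [|g _]; first by rewrite invr_gt0.
  by right; rewrite mulVf// gt_eqF.
- have size_gt0 : 0 < alpha * d%:R + beta * (1 - alpha * d%:R).
    by rewrite ltr_wpDr// mulr_ge0// ltW.
  rewrite -mulrA -[d%:R / _]invf_div; apply: bound => [|g /andP[_ g_lt]].
    exact: divr_gt0.
  by left; rewrite divfK ?gt_eqF// lerD2l ler_wpM2r// ltW.
Qed.
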